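(* For any flat diagram $\mathcal{R}$ of rings let $\kappa:=(|\mathcal{L}_{\mathcal{R}}|+\aleph_0)^+$, let $\lambda$ be a regular cardinal with $\mu^{|\mathcal{L}_{\mathcal{R}}|+\aleph_0}<\lambda$ for all $\mu<\lambda$, and let $\Gamma$ be the class of $\mathcal{L}_{\mathcal{R}}$-appropriate structures in $[V]^{<\lambda}$ that are $<\kappa$-closed (this class is stationary in $[V]^{<\lambda}$). Then the class of Drinfeld vector bundles in $\text{Qcoh}(\mathcal{R})$ has the Kaplansky Property on $\Gamma$. In particular, the class of Drinfeld vector bundles is a $<\lambda$-Uniformly Stationary Kaplansky class for $\lambda=\left(2^{|\mathcal{L}_{\mathcal{R}}|+\aleph_0}\right)^+$.
   Context: **$\text{Qcoh}(\mathcal{R})$.** A flat diagram of rings is a functor $\mathcal{R}:\mathcal{Q}\to\text{Rings}$ on a small category $\mathcal{Q}$ such that for each arrow $v\to w$, $\mathcal{R}(w)$ is flat over $\mathcal{R}(v)$ (i.e. $\mathcal{R}(w)\otimes_{\mathcal{R}(v)}-$ is exact). An $\mathcal{R}$-module $\mathcal{M}$ assigns functorially to each $v$ an $\mathcal{R}(v)$-module $\mathcal{M}(v)$ and to each arrow $a:v\to w$ an $\mathcal{R}(v)$-linear map $\mathcal{M}(a):\mathcal{M}(v)\to\mathcal{M}(w)$; morphisms are families of $\mathcal{R}(v)$-linear maps commuting with the $\mathcal{M}(a)$. It is quasicoherent if for every $a:v\to w$ the map $\mathcal{R}(w)\otimes_{\mathcal{R}(v)}\mathcal{M}(v)\to\mathcal{M}(w)$,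 $s\otimes x\mapsto s\cdot\mathcal{M}(a)(x)$, is an isomorphism. $\text{Qcoh}(\mathcal{R})$ is the full subcategory of quasicoherent $\mathcal{R}$-modules. $\mathcal{L}_{\mathcal{R}}$ is the finitary signature with one sort for each object $v$ of $\mathcal{Q}$, abelian group symbols and unary symbols $\cdot_r$ ($r\in\mathcal{R}(v)$) on sort $v$, and a unary function symbol $F_a$ from sort $u$ to sort $v$ for each arrow $a:u\to v$; $|\mathcal{L}_{\mathcal{R}}|$ is its number of symbols. $\mathcal{R}$-modules are viewed as $\mathcal{L}_{\mathcal{R}}$-structures with underlying set $\bigsqcup_v\mathcal{M}(v)$. **Drinfeld vector bundles.** A module $M$ over a ring $A$ is flat Mittag-Leffler if it is flat and for every family $(Q_i)_{i\in I}$ of right $A$-modules the canonical map $(\prod_i Q_i)\otimes_A M\to\prod_i(Q_i\otimes_A M)$ is injective. An object $D$ of $\text{Qcoh}(\mathcal{R})$ is a Drinfeld vector bundle if $D(v)$ is a flat Mittag-Leffler $\mathcal{R}(v)$-module for every object $v$ of $\mathcal{Q}$. **Stationarity.** $V$ is the universe of sets; a set $N$ is identified with $\mathfrak{N}=(N,\in)$, and $\prec_1$ means $\Sigma_1$-elementarity. $[V]^{<\lambda}$ is the class of sets of size $<\lambda$. For regular uncountable $\lambda$, a class $\Gamma\subseteq[V]^{<\lambda}$ is stationary in $[V]^{<\lambda}$ if for every set $P$ with $|P|<\lambda$ there is $N\in\Gamma$ with $P\subset\mathfrak{N}\prec_1(V,\in)$ and $N\cap\lambda$ an ordinal. $N$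 is $<\kappa$-closed if every subset of $N$ of size $<\kappa$ is an element of $N$. $\mathfrak{N}$ is $\mathcal{L}_{\mathcal{R}}$-appropriate if $\mathcal{L}_{\mathcal{R}}\cup\{\mathcal{L}_{\mathcal{R}}\}\subset\mathfrak{N}\prec_1(V,\in)$. **Kaplansky Property.** A class $\mathbf{K}$ of objects of $\text{Qcoh}(\mathcal{R})$ has the Kaplansky Property on $\Gamma$ if for every $\mathfrak{N}\in\Gamma$ and every $K\in\mathfrak{N}\cap\mathbf{K}$, both $\mathfrak{N}\cap K$ (a substructure of $K$) and $K/(\mathfrak{N}\cap K)$ are in $\mathbf{K}$. $\mathbf{K}$ is $<\lambda$-Uniformly Stationary Kaplansky if it has the Kaplansky Property on some stationary $\Gamma\subset[V]^{<\lambda}$. *)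

(* Defs.v *)
From HB Require Import structures.
From mathcomp Require Import all_boot all_algebra.
From mathcomp Require Import generic_quotient ring_quotient freeg.
From mathcomp Require Import mathcomp_extra boolp classical_sets functions.
From mathcomp Require Import cardinality.

Set Implicit Arguments.
Unset Strict Implicit.
Unset Printing Implicit Defensive.

Import GRing.Theory.
Import Quotient.

Local Open Scope classical_set_scope.
Local Open Scope card_scope.
Local Open Scope ring_scope.
Local Open Scope quotient_scope.

(* A universe of sets is a model (V, \in) of ZFC in which the classes are all
   the predicates on V, so that Replacement is quantified over all functional
   relations: Aczel's type of well-founded trees, modulo bisimulation, is one.
   The point of the carrier is an arbitrary element of V: it is only used as
   the default value of [get]. *)
Record zfc := ZFC {
  zfc_sort :> pointedType;
  vin : zfc_sort -> zfc_sort -> Prop;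
  zfc_ext : forall x y, (forall z, vin z x <-> vin z y) -> x = y;
  zfc_foundation : forall x, (exists y, vin y x) ->
    exists y, vin y x /\ forall z, vin z x -> ~ vin z y;
  zfc_pairing : forall x y, exists p, forall z, vin z p <-> z = x \/ z = y;
  zfc_union : forall x, exists u,
    forall z, vin z u <-> exists y, vin y x /\ vin z y;
  zfc_power : forall x, exists p,
    forall z, vin z p <-> forall t, vin t z -> vin t x;
  zfc_infinity : exists w,
    (exists e, vin e w /\ forall z, ~ vin z e) /\
    (forall x, vin x w ->
       exists s, vin s w /\ forall z, vin z s <-> vin z x \/ z = x);
  zfc_replacement : forall (F : zfc_sort -> zfc_sort -> Prop) x,
    (forall y z z', vin y x -> F y z -> F y z' -> z = z') ->
    exists r, forall z, vin z r <-> exists y, vin y x /\ F y z;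
  zfc_choice : forall x,
    (forall y, vin y x -> exists z, vin z y) ->
    (forall y y' z, vin y x -> vin y' x -> vin z y -> vin z y' -> y = y') ->
    exists c, forall y, vin y x -> exists! z, vin z y /\ vin z c
}.

Notation "x ∈ y" := (vin x y) (at level 70).

Section Sets.
Variable V : zfc.
Implicit Types (x y z s : V) (P : set V).

Definition El s : Type := set_type [set x : V | x ∈ s].
HB.instance Definition _ s := Choice.on (El s).

(* {x | P x}, which is meant for classes P that are sets. *)
Definition vset P : V := get [set s | forall x, x ∈ s <-> P x].

Lemma vsetE P : (exists s, forall x, x ∈ s <-> P x) ->
  forall x, x ∈ vset P <-> P x.
Proof. by move=> [s sP]; rewrite /vset; case: xgetP => [r _|/(_ s)]. Qed.

Definition vsub x y := forall z, z ∈ x -> z ∈ y.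
Definition vinter x y := vset [set z | z ∈ x /\ z ∈ y].
Definition vupair x y := vset [set z | z = x \/ z = y].
Definition vpair x y := vupair (vupair x x) (vupair x y).

Fixpoint vnat (n : nat) : V :=
  if n is m.+1 then vset [set z | z ∈ vnat m \/ z = vnat m] else vset set0.

Definition transitive_set x := forall y, y ∈ x -> vsub y x.
Definition ordinal x := transitive_set x /\ forall y, y ∈ x -> transitive_set y.
Definition cardinal x :=
  ordinal x /\ forall y, y ∈ x -> ~ ([set: El y] #= [set: El x]).

(* Meant for types T in bijection with the elements of a set of V. *)
Definition card_of (T : Type) : V :=
  get [set c | cardinal c /\ [set: T] #= [set: El c]].

Definition vcard x := card_of (El x).

Definition succ_card x : V :=
  get [set c | [/\ cardinal c, x ∈ c &
    forall d, cardinal d -> x ∈ d -> c = d \/ c ∈ d]].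

Definition regular x := [/\ cardinal x, infinite_set [set: El x] &
  forall s, vsub s x -> vcard s ∈ x ->
    exists2 b, b ∈ x & forall y, y ∈ s -> y ∈ b].

Definition uncountable x := ~ countable [set: El x].

End Sets.

(* Formulas of set theory, with variables named by natural numbers. *)
Inductive formula :=
| FEq of nat & nat
| FIn of nat & nat
| FNot of formula
| FAnd of formula & formula
| FEx of nat & formula.

Inductive delta0 : formula -> Prop :=
| delta0_eq i j : delta0 (FEq i j)
| delta0_in i j : delta0 (FIn i j)
| delta0_not p : delta0 p -> delta0 (FNot p)
| delta0_and p q : delta0 p -> delta0 q -> delta0 (FAnd p q)
| delta0_ex i j p : i != j -> delta0 p -> delta0 (FEx i (FAnd (FIn i j) p)).

Inductive sigma1 : formula -> Prop :=
| sigma1_delta0 p : delta0 p -> sigma1 p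
| sigma1_ex i p : sigma1 p -> sigma1 (FEx i p).

Section Stationary.
Variable V : zfc.
Implicit Types (x y z s N P lambda kappa : V) (Gamma : set V).

Fixpoint sat (D : set V) (e : nat -> V) (p : formula) : Prop :=
  match p with
  | FEq i j => e i = e j
  | FIn i j => e i ∈ e j
  | FNot q => ~ sat D e q
  | FAnd q r => sat D e q /\ sat D e r
  | FEx i q => exists2 x, D x & sat D (fun j => if j == i then x else e j) q
  end.

(* (N, \in) is a Sigma_1-elementary substructure of (V, \in); as a structure it
   is non-empty, which the second clause alone would not imply. *)
Definition elem1 N := (exists x, x ∈ N) /\
  forall (p : formula) (e : nat -> V), sigma1 p -> (forall i, e i ∈ N) ->
    (sat [set x | x ∈ N] e p <-> sat setT e p).

Definition smaller_than lambda : set V := [set x | vcard x ∈ lambda].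

Definition stationary lambda Gamma :=
  [/\ regular lambda, uncountable lambda, Gamma `<=` smaller_than lambda &
    forall P, smaller_than lambda P ->
      exists2 N, Gamma N & [/\ vsub P N, elem1 N & ordinal (vinter N lambda)]].

Definition lt_closed kappa N :=
  forall s, vsub s N -> smaller_than kappa s -> s ∈ N.

End Stationary.

(* A right A-module is a left A^c-module. *)
Section Tensor.
Variables (A : pzRingType) (Q : lmodType A^c) (M : lmodType A).

Definition tgen (q : Q) (m : M) : {freeg (Q * M)} := << (q, m) >>.

Inductive tens_rel : {freeg (Q * M)} -> Prop :=
| tens_rel0 : tens_rel 0
| tens_relB x y : tens_rel x -> tens_rel y -> tens_rel (x - y)
| tens_relDl q q' m : tens_rel (tgen (q + q') m - (tgen q m + tgen q' m))
| tens_relDr q m m' : tens_rel (tgen q (m + m') - (tgen q m + tgen q m'))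
| tens_relZ q (a : A) m : tens_rel (tgen ((a : A^c) *: q) m - tgen q (a *: m)).

Definition tens_sub : {pred {freeg (Q * M)}} := fun x => `[< tens_rel x >].

Lemma tens_sub_closed : zmod_closed tens_sub.
Proof.
split; first by apply/asboolP; exact: tens_rel0.
by move=> x y /asboolP xI /asboolP yI; apply/asboolP; exact: tens_relB.
Qed.

HB.instance Definition _ :=
  GRing.isZmodClosed.Build {freeg (Q * M)} tens_sub tens_sub_closed.

Definition tens : Type := {quot tens_sub}.
HB.instance Definition _ := GRing.Zmodule.on tens.

Definition tpure (q : Q) (m : M) : tens := \pi_{quot tens_sub} (tgen q m).

(* The additive map sending each pure tensor q (x) m to b q m, when b is
   balanced. *)
Definition tens_lift (Z : zmodType) (b : Q -> M -> Z) (t : tens) : Z :=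
  fglift (fun p : Q * M => b p.1 p.2 : zmodule Z) (repr t).

Definition balanced (Z : zmodType) (b : Q -> M -> Z) :=
  [/\ forall q q' m, b (q + q') m = b q m + b q' m,
      forall q m m', b q (m + m') = b q m + b q m' &
      forall q (a : A) m, b ((a : A^c) *: q) m = b q (a *: m)].

Section Lift.
Variables (Z : zmodType) (b : Q -> M -> Z).
Let ev (x : {freeg (Q * M)}) : Z :=
  fglift (fun p : Q * M => b p.1 p.2 : zmodule Z) x.

Let evB x y : ev (x - y) = ev x - ev y.
Proof. exact: (@lift_is_additive int _ (zmodule Z)). Qed.

Let ev_gen q m : ev (tgen q m) = b q m.
Proof. by rewrite /ev /tgen liftU scale1r. Qed.

Let ev0 : ev 0 = 0.
Proof. by have := evB 0 0; rewrite !subrr. Qed.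

Let evD x y : ev (x + y) = ev x + ev y.
Proof.
by rewrite -{1}[y]opprK -[- y]sub0r !evB ev0 sub0r opprK.
Qed.

Hypothesis bal : balanced b.

Let ev_rel x : tens_rel x -> ev x = 0.
Proof.
case: bal => bDl bDr bZ; elim=> {x}.
- exact: ev0.
- by move=> x y _ ex _ ey; rewrite evB ex ey subrr.
- by move=> q q' m; rewrite evB evD !ev_gen bDl subrr.
- by move=> q m m'; rewrite evB evD !ev_gen bDr subrr.
- by move=> q a m; rewrite evB !ev_gen bZ subrr.
Qed.

Let lift_pi x : tens_lift b (\pi_{quot tens_sub} x) = ev x.
Proof.
rewrite -[LHS]/(ev (repr _)).
have : repr (\pi_{quot tens_sub} x) - x \in tens_sub.
  by rewrite idealrBE reprK.
by move=> /asboolP/ev_rel /eqP; rewrite evB subr_eq0 => /eqP.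
Qed.

Lemma tens_liftE q m : tens_lift b (tpure q m) = b q m.
Proof. by rewrite lift_pi ev_gen. Qed.

Lemma tens_liftD t u : tens_lift b (t + u) = tens_lift b t + tens_lift b u.
Proof.
elim/quotW: t => t; elim/quotW: u => u.
by rewrite -[\pi t + _](@pi_addr _ _ _ _ _ {quot tens_sub}) !lift_pi evD.
Qed.

End Lift.
End Tensor.

Definition tens_map (A : pzRingType) (Q Q' : lmodType A^c) (M M' : lmodType A)
    (f : Q -> Q') (g : M -> M') : tens Q M -> tens Q' M' :=
  tens_lift (fun q m => tpure (f q) (g m)).

(* The target of a morphism of rings, as a right module over its source. *)
Definition rrestr (A B : pzRingType) (phi : {rmorphism A -> B}) : Type := B.

Section Restriction.
Variables (A B : pzRingType) (phi : {rmorphism A -> B}).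
HB.instance Definition _ := GRing.Zmodule.on (rrestr phi).

Let scale (a : A^c) (b : rrestr phi) : rrestr phi := (b : B) * phi a.

Let scaleA a b v : scale a (scale b v) = scale (a * b) v.
Proof. by rewrite /scale -mulrA -rmorphM. Qed.
Let scale1 : left_id 1 scale.
Proof. by move=> v; rewrite /scale rmorph1 mulr1. Qed.
Let scaleDr : right_distributive scale +%R.
Proof. by move=> a u v; rewrite /scale mulrDl. Qed.
Let scaleDl v : {morph scale^~ v : a b / a + b}.
Proof. by move=> a b; rewrite /scale rmorphD mulrDr. Qed.

HB.instance Definition _ := GRing.Zmodule_isLmodule.Build A^c (rrestr phi)
  scaleA scale1 scaleDr scaleDl.
End Restriction.

Definition prodmod (A : pzRingType) (I : Type) (Q : I -> lmodType A) : Type :=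
  forall i, Q i.

Section Product.
Variables (A : pzRingType) (I : Type) (Q : I -> lmodType A).
Local Notation P := (prodmod Q).
Implicit Types f g h : P.

Let add f g : P := fun i => f i + g i.
Let opp f : P := fun i => - f i.
Let zero : P := fun=> 0.
Let scale (a : A) f : P := fun i => a *: f i.

Let ext f g : (forall i, f i = g i) -> f = g.
Proof. exact: functional_extensionality_dep. Qed.

Let addA : associative add.
Proof. by move=> f g h; apply: ext => i; exact: addrA. Qed.
Let addC : commutative add.
Proof. by move=> f g; apply: ext => i; exact: addrC. Qed.
Let add0 : left_id zero add.
Proof. by move=> f; apply: ext => i; exact: add0r. Qed.
Let addN : left_inverse zero opp add.
Proof. by move=> f; apply: ext => i; exact: addNr. Qed.

HB.instance Definition _ := gen_eqMixin P.
HB.instance Definition _ := gen_choiceMixin P.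
HB.instance Definition _ := GRing.isZmodule.Build P addA addC add0 addN.

Let scaleA a b f : scale a (scale b f) = scale (a * b) f.
Proof. by apply: ext => i; exact: scalerA. Qed.
Let scale1 : left_id 1 scale.
Proof. by move=> f; apply: ext => i; exact: scale1r. Qed.
Let scaleDr : right_distributive scale +%R.
Proof. by move=> a f g; apply: ext => i; exact: scalerDr. Qed.
Let scaleDl f : {morph scale^~ f : a b / a + b}.
Proof. by move=> a b; apply: ext => i; exact: scalerDl. Qed.

HB.instance Definition _ := GRing.Zmodule_isLmodule.Build A P
  scaleA scale1 scaleDr scaleDl.
End Product.

(* Rings and modules whose underlying set is an element of V. *)
Record vring (V : zfc) := VRing {
  vring_set : V;
  vring_class : GRing.PzRing.axioms_ (El vring_set)
}.
Definition vring_ring V (A : vring V) : pzRingType :=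
  GRing.PzRing.Pack (vring_class A).
Coercion vring_ring : vring >-> GRing.PzRing.type.

Record vmod (V : zfc) (A : pzRingType) := VMod {
  vmod_set : V;
  vmod_class : GRing.Lmodule.axioms_ A (El vmod_set)
}.
Definition vmod_lmod V A (M : vmod V A) : lmodType A :=
  GRing.Lmodule.Pack (vmod_class M).
Coercion vmod_lmod : vmod >-> GRing.Lmodule.type.

Definition vring_val V (A : vring V) (a : A) : V := \val (a : El (vring_set A)).
Definition vmod_val V A (M : vmod V A) (x : M) : V := \val (x : El (vmod_set M)).

Section Flat.
Variables (V : zfc) (A : pzRingType).

Definition exact_at (X Y Z : nmodType) (f : X -> Y) (g : Y -> Z) :=
  forall y, g y = 0 <-> exists x, f x = y.

Definition flat_right (Q : lmodType A^c) :=
  forall (X Y Z : vmod V A) (f : {linear X -> Y}) (g : {linear Y -> Z}),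
    exact_at f g ->
    exact_at (@tens_map A Q Q X Y id f) (@tens_map A Q Q Y Z id g).

Definition flat_left (M : lmodType A) :=
  forall (X Y Z : vmod V A^c) (f : {linear X -> Y}) (g : {linear Y -> Z}),
    exact_at f g ->
    exact_at (@tens_map A X Y M M f id) (@tens_map A Y Z M M g id).

(* The canonical map from (prod_i Q i) (x) M to prod_i (Q i (x) M). *)
Definition tens_prod (I : Type) (Q : I -> lmodType A^c) (M : lmodType A)
    (t : tens (prodmod Q) M) : forall i, tens (Q i) M :=
  fun i => @tens_map A (prodmod Q) (Q i) M M (fun q => q i) id t.

Definition mittag_leffler (M : lmodType A) :=
  forall (I : V) (Q : El I -> vmod V A^c),
    injective (@tens_prod (El I) (fun i => Q i) M).

Definition flat_mittag_leffler (M : lmodType A) :=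
  flat_left M /\ mittag_leffler M.

End Flat.

(* Rings are unital, not necessarily commutative, and may be zero. *)
Record diagram (V : zfc) := Diagram {
  obj : V;
  hom : El obj -> El obj -> V;
  idm : forall u, El (hom u u);
  comp : forall u v w, El (hom v w) -> El (hom u v) -> El (hom u w);
  comp_idl : forall u v (a : El (hom u v)), comp (idm v) a = a;
  comp_idr : forall u v (a : El (hom u v)), comp a (idm u) = a;
  compA : forall u v w z (c : El (hom w z)) (b : El (hom v w)) (a : El (hom u v)),
    comp c (comp b a) = comp (comp c b) a;
  dring :> El obj -> vring V;
  dmap : forall u v, El (hom u v) -> {rmorphism dring u -> dring v};
  dmap_id : forall u r, dmap (idm u) r = r;
  dmap_comp : forall u v w (b : El (hom v w)) (a : El (hom u v)) r,
    dmap (comp b a) r = dmap b (dmap a r)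
}.

Section Diagrams.
Variables (V : zfc) (R : diagram V).
Local Notation O := (El (obj R)).

Definition flat_diagram :=
  forall (u v : O) (a : El (hom u v)), flat_right V (rrestr (dmap a)).

Record rmodule := RModule {
  rmod :> forall u : O, vmod V (R u);
  rmap : forall u v (a : El (hom u v)),
    {linear rmod u -> rmod v | (dmap a) \; *:%R};
  rmap_id : forall u x, rmap (idm u) x = x;
  rmap_comp : forall u v w (b : El (hom v w)) (a : El (hom u v)) x,
    rmap (comp b a) x = rmap b (rmap a x)
}.

Record rhom (K L : rmodule) := RHom {
  rhom_map :> forall u, {linear K u -> L u};
  rhom_nat : forall u v (a : El (hom u v)) x,
    rhom_map v (rmap K a x) = rmap L a (rhom_map u x)
}.

(* The map s (x) x |-> s * K(a)(x). *)
Definition ext_map (K : rmodule) u v (a : El (hom u v)) :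
    tens (rrestr (dmap a)) (K u) -> K v :=
  tens_lift (fun (s : rrestr (dmap a)) (x : K u) => (s : R v) *: rmap K a x).

Definition quasicoherent (K : rmodule) :=
  forall u v (a : El (hom u v)), bijective (@ext_map K u v a).

Record qcoh := QCoh {
  qcoh_rmod :> rmodule;
  _ : quasicoherent qcoh_rmod
}.

Definition drinfeld : set qcoh :=
  [set D : qcoh | forall u : O, flat_mittag_leffler V (rmod D u)].

(* The sort u is the object u: the sorts are not counted as symbols, and the
   code of a symbol determines the sorts of its arguments and of its value. *)
Inductive symbol :=
| SZero of O
| SAdd of O
| SOpp of O
| SScale (u : O) of R u
| SArr (u v : O) of El (hom u v).

Definition symbol_code (f : symbol) : V :=
  match f with
  | SZero u => vpair (vnat V 0) (\val u)
  | SAdd u => vpair (vnat V 1) (\val u)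
  | SOpp u => vpair (vnat V 2) (\val u)
  | SScale u r => vpair (vnat V 3) (vpair (\val u) (vring_val r))
  | SArr u v a => vpair (vnat V 4) (vpair (vpair (\val u) (\val v)) (\val a))
  end.

Definition signature : V := vset (range symbol_code).

(* The element x of K(u), as an element of the disjoint union of the K(u). *)
Definition kelt (K : rmodule) u (x : K u) : V := vpair (\val u) (vmod_val x).

Definition underlying_set (K : rmodule) : V :=
  vset [set z | exists u, exists x : K u, z = kelt x].

Definition interp (K : rmodule) (f : symbol) : V :=
  match f with
  | SZero u => kelt (0 : K u)
  | SAdd u => vset [set z | exists x y : K u,
      z = vpair (vpair (kelt x) (kelt y)) (kelt (x + y))]
  | SOpp u => vset [set z | exists x : K u, z = vpair (kelt x) (kelt (- x))]
  | SScale u r => vset [set z | exists x : K u,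
      z = vpair (kelt x) (kelt (r *: x))]
  | SArr u v a => vset [set z | exists x : K u,
      z = vpair (kelt x) (kelt (rmap K a x))]
  end.

(* An R-module as a structure for the signature, which is an element of V: the
   pair of the underlying set and of the interpretation function. *)
Definition structure_of (K : rmodule) : V :=
  vpair (underlying_set K)
        (vset [set z | exists f, z = vpair (symbol_code f) (interp K f)]).

Definition trace (N : V) (K : rmodule) (u : O) : set (K u) :=
  [set x | kelt x ∈ N].
Arguments trace : clear implicits.

(* L is the substructure of K with underlying sets S u. *)
Definition is_substructure (K : rmodule) (S : forall u, set (K u))
    (L : rmodule) :=
  exists i : rhom L K, forall u,
    (forall x, vmod_val (i u x) = vmod_val x) /\ range (i u) = S u.

(* L is the quotient of K by the S u: its elements are the cosets. *)
Definition is_quotient (K : rmodule) (S : forall u, set (K u))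
    (L : rmodule) :=
  exists p : rhom K L, forall u, range (p u) = setT /\
    forall x z, z ∈ vmod_val (p u x) <->
                exists2 y, S u (y - x) & z = vmod_val y.

Definition kaplansky (C : set qcoh) (Gamma : set V) :=
  forall N (K : qcoh), Gamma N -> C K -> structure_of K ∈ N ->
    (exists2 L, C L & is_substructure (trace N K) L) /\
    (exists2 L, C L & is_quotient (trace N K) L).

Definition uniformly_stationary_kaplansky (lambda : V) (C : set qcoh) :=
  exists2 Gamma, stationary lambda Gamma & kaplansky C Gamma.

Definition appropriate (N : V) :=
  [/\ vsub signature N, signature ∈ N & elem1 N].

End Diagrams.

(* Main.v *)
Require Import Defs.
From HB Require Import structures.
From mathcomp Require Import all_boot all_algebra.
From mathcomp Require Import generic_quotient ring_quotient freeg.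
From mathcomp Require Import boolp classical_sets functions cardinality.
From mathcomp Require wochoice.
From Stdlib Require Import Wellfounded.Inverse_Image.
Import Defs.

(** Let [N] be a Sigma_1-elementary submodel that has among its elements all
    its subsets of size at most theta, the number of symbols plus aleph_0, and
    let [K] in [N] be a Drinfeld vector bundle. The closure of [N] makes its
    trace [L] on [K] pure in a strong sense: if [S] is a set of at most theta
    elements of [K], then some map [rho] from [S] to [L] fixes the elements of
    [S] in [L] and preserves all the relations between elements of [S] that
    the operations of [K] express ([retract_exists]). Indeed, index [S] by
    elements of [N]. The set of the relations between the indices and the list
    of the elements of [S] in [N] are subsets of [N] of size at most theta,
    hence elements of [N]. That some family of sets satisfies these relations
    and has the prescribed members is a Sigma_1 statement about them, which
    [S] witnesses; so there is such a family in [N] ([reflect_set]).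

    All that concerns [L] and [K/L] follows from these partial retractions
    ([pure_substructure]). A sum of pure tensors that vanishes does so because
    of finitely many instances of the linearity of the second variable
    ([tsum0_respects]), hence it still vanishes after the application to the
    second factor of any map that respects these instances. The map [rho] brings
    a relation over [K] down to [L], and x - [rho] x depends only on the coset
    of x modulo [L], hence lifts a relation over [K/L] to [K]. In this way
    flatness, the Mittag-Leffler property and quasicoherence pass from [K] to
    [L] and to [K/L]. The Mittag-Leffler property of [K/L] is the only one for
    which infinitely many relations, one for each factor of a product, have to
    be lifted by the same [rho]. The shape of a relation is a finite list with
    coefficients in a ring of size at most theta, so there are at most theta
    shapes, and a single solution of each shape is enough.

    A closed elementary submodel that contains a given set of size less than
    lambda is the union of a chain of length theta^+, along which one adds
    Skolem witnesses, the subsets of size at most theta, and upper bounds in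
    lambda ([hull]). The sizes remain below lambda because mu^theta < lambda
    for mu < lambda, and the union is closed because theta^+ is regular. The
    cardinal arithmetic of the model, that is [hessenberg] and
    [succ_card_regular], rests on the collapse of well-orders to ordinals. *)

Set Implicit Arguments.
Unset Strict Implicit.
Unset Printing Implicit Defensive.

Local Open Scope classical_set_scope.
Local Open Scope card_scope.

(** * Embeddings and small types *)

Definition embeds (T U : Type) := exists f : T -> U, injective f.

Lemma embeds_refl T : embeds T T.
Proof. by exists id. Qed.

Lemma embeds_trans T U W : embeds T U -> embeds U W -> embeds T W.
Proof. by move=> [f fi] [g gi]; exists (g \o f); exact: inj_comp. Qed.

Lemma embedsP T U : embeds T U <-> [set: T] #<= [set: U].
Proof.
split=> [[f fi]|/card_leP[f]].
  have /injfunPex[g] : exists2 g : T -> U, set_fun [set: T] [set: U] g &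
      set_inj [set: T] g by exists f => // x y _ _; exact: fi.
  exact: inj_card_le g.
exists (fun x => \val (f (exist _ x (in_setT x)))) => x y /val_inj.
by move=> /(@inj _ _ _ f _ _ (in_setT _) (in_setT _)) [].
Qed.

Lemma embeds_antisym T U : embeds T U -> embeds U T -> [set: T] #= [set: U].
Proof. by move=> /embedsP tu /embedsP ut; rewrite card_eq_le tu ut. Qed.

Lemma card_eq_embeds T U : [set: T] #= [set: U] -> embeds T U.
Proof. by rewrite card_eq_le => /andP[/embedsP]. Qed.

Lemma embeds_prod T T' U U' :
  embeds T U -> embeds T' U' -> embeds (T * T') (U * U').
Proof.
move=> [f fi] [g gi]; exists (fun p => (f p.1, g p.2)).
by move=> [a b] [c d] /= [/fi-> /gi->].
Qed.

Lemma embeds_fun T U U' : embeds U U' -> embeds (T -> U) (T -> U').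
Proof.
move=> [f fi]; exists (fun h => f \o h) => h k hk.
by apply/funext => t; apply: fi; move: hk => /(congr1 (@^~ t)).
Qed.

Lemma embeds_funl T T' U : embeds T T' -> U -> embeds (T -> U) (T' -> U).
Proof.
move=> [f fi] u.
exists (fun h t' => if pselect (exists t, f t = t') is left e
                    then h (projT1 (cid e)) else u) => h k hk.
apply/funext => t; move: hk => /(congr1 (@^~ (f t))) /=.
by case: pselect => [e|[]]; [case: cid => /= s /fi ->|exists t].
Qed.

(** Choosing a [u] for each [t] is injective because [F] is functional; no
    inverse map has to be defined outside of the domain of [F]. *)
Lemma embeds_rel T U (F : U -> T -> Prop) :
  (forall t, exists u, F u t) -> (forall u t t', F u t -> F u t' -> t = t') ->
  embeds T U.
Proof.
move=> ex fn; exists (fun t => projT1 (cid (ex t))) => t t'.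
by case: cid => u ut; case: cid => u' ut' /= e; apply: fn ut _; rewrite e.
Qed.

Lemma embeds_surj T U (f : U -> T) : (forall t, exists u, f u = t) -> embeds T U.
Proof. by move=> fs; apply: (embeds_rel (F := fun u t => f u = t)) => // u t t' ->. Qed.

Section Sets.
Variable V : zfc.
Implicit Types (x y z s : V) (P : set V).

Definition elm s x (h : x ∈ s) : El s := exist _ x (mem_set h).

Lemma elP s (a : El s) : \val a ∈ s.
Proof. exact: (set_valP a). Qed.

Lemma el_inj s : injective (fun a : El s => \val a : V).
Proof. exact: val_inj. Qed.

Lemma el_sub x y : vsub x y -> embeds (El x) (El y).
Proof.
move=> xy; exists (fun a : El x => elm (xy _ (elP a))) => a b.
by move=> /(congr1 val) /= /el_inj.
Qed.

Lemma v_sep x P : exists s, forall z, z ∈ s <-> z ∈ x /\ P z.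
Proof.
have [|s sP] := @zfc_replacement V (fun y z => y = z /\ P y) x.
  by move=> y z z' _ [<- _] [].
exists s => z; rewrite sP; split=> [[y [yx [<-]]]|[zx Pz]] //.
by exists z.
Qed.

(** The types to which the cardinal arithmetic of [V] applies; on the others
    [card_of] has no meaning. *)
Definition small T := exists s, embeds T (El s).

Lemma small_El s : small (El s).
Proof. by exists s; exact: embeds_refl. Qed.

Lemma small_embeds T U : embeds T U -> small U -> small T.
Proof. by move=> TU [s Us]; exists s; exact: embeds_trans Us. Qed.

Lemma small_range T (f : T -> V) : small T ->
  exists s, forall z, z ∈ s <-> exists t, z = f t.
Proof.
move=> [s [g gi]].
have [|r rP] := @zfc_replacement V
    (fun y z => exists t, \val (g t) = y /\ z = f t) s.
  by move=> y z z' _ [t [<- ->]] [t' [/el_inj/gi -> ->]].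
exists r => z; rewrite rP; split=> [[y [_ [t [_ ->]]]]|[t ->]]; first by exists t.
by exists (\val (g t)); split; [exact: elP|exists t].
Qed.

Lemma vset_smallE T (f : T -> V) P : small T -> (forall z, P z <-> exists t, z = f t) ->
  forall z, z ∈ vset P <-> P z.
Proof.
move=> sT Pf; apply: vsetE; have [s sP] := small_range f sT.
by exists s => z; rewrite sP Pf.
Qed.

Lemma vset_sub P x : (forall z, P z -> z ∈ x) -> forall z, z ∈ vset P <-> P z.
Proof.
move=> Px; apply: vsetE; have [s sP] := v_sep x P.
by exists s => z; rewrite sP; split=> [[]//|Pz]; split=> //; exact: Px.
Qed.

Lemma vinterE x y z : z ∈ vinter x y <-> z ∈ x /\ z ∈ y.
Proof. by apply: (vset_sub (x := x)) => ? []. Qed.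

Lemma vupairE x y z : z ∈ vupair x y <-> z = x \/ z = y.
Proof. by apply: vsetE; exact: zfc_pairing. Qed.

Lemma vupair_inj1 x y : vupair x x = vupair x y -> x = y.
Proof.
move=> e; have : y ∈ vupair x x by rewrite e; apply/vupairE; right.
by move=> /vupairE[].
Qed.

Lemma vpair_inj x y x' y' : vpair x y = vpair x' y' -> x = x' /\ y = y'.
Proof.
move=> e.
have hx : x = x'.
  have : vupair x x ∈ vpair x' y' by rewrite -e; apply/vupairE; left.
  move=> /vupairE[] h; have : x' ∈ vupair x x by rewrite h; apply/vupairE; left.
    by move=> /vupairE[].
  by move=> /vupairE[].
split=> //; subst x'.
have h1 : vupair x y ∈ vpair x y' by rewrite -e; apply/vupairE; right.
have h2 : vupair x y' ∈ vpair x y by rewrite e; apply/vupairE; right.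
move: h1 h2 => /vupairE[] h1 /vupairE[] h2.
- have := vupair_inj1 (esym h1); have := vupair_inj1 (esym h2).
  by move=> <- <-.
- by have := vupair_inj1 (esym h1) => xy; move: h2; rewrite -xy => /esym/vupair_inj1.
- by have := vupair_inj1 (esym h2) => xy; move: h1; rewrite -xy => /esym/vupair_inj1.
- have : y ∈ vupair x y' by rewrite -h1; apply/vupairE; right.
  move=> /vupairE[] // yx.
  have : y' ∈ vupair x y by rewrite -h2; apply/vupairE; right.
  by rewrite yx => /vupairE[].
Qed.

Lemma vnonself x : ~ x ∈ x.
Proof.
move=> xx; have [|y [/vupairE yx ym]] := @zfc_foundation V (vupair x x).
  by exists x; apply/vupairE; left.
have {}yx : y = x by case: yx.
by apply: (ym x); [|rewrite yx]; first by apply/vupairE; left.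
Qed.

Lemma vnocycle x y : x ∈ y -> ~ y ∈ x.
Proof.
move=> xy yx; have [|z [/vupairE zx zm]] := @zfc_foundation V (vupair x y).
  by exists x; apply/vupairE; left.
case: zx => e; subst z.
  by apply: (zm y) => //; apply/vupairE; right.
by apply: (zm x) => //; apply/vupairE; left.
Qed.

(** The pairs form a set by Replacement, applied twice, and Union. *)
Lemma small_sigma T (U : T -> Type) : small T -> (forall t, small (U t)) ->
  small {t : T & U t}.
Proof.
move=> [s [f fi]] sU; have [su suP] := choice sU.
pose g t := projT1 (cid (suP t)).
have gi t : injective (g t) := projT2 (cid (suP t)).
have row t : exists r, forall z, z ∈ r <->
    exists y : El (su t), z = vpair (\val (f t)) (\val y).
  by apply: small_range; exact: small_El.
have [r rP] := choice row.
have [m mP] := small_range r (ex_intro _ s (ex_intro _ f fi)).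
have [u uP] := zfc_union m.
have hu (p : {t : T & U t}) :
    vpair (\val (f (tag p))) (\val (g (tag p) (tagged p))) ∈ u.
  apply/uP; exists (r (tag p)); split; first by apply/mP; exists (tag p).
  by apply/rP; exists (g (tag p) (tagged p)).
exists u; exists (fun p => elm (hu p)) => -[t a] [t' a'] /(congr1 val) /=.
by move=> /vpair_inj[/el_inj/fi tt']; subst t' => /el_inj/gi ->.
Qed.

Lemma small_prod T U : small T -> small U -> small (T * U).
Proof.
move=> sT sU; have := small_sigma sT (fun=> sU); apply: small_embeds.
by exists (fun p => existT (fun=> U) p.1 p.2) => -[a b] [c d] /= [-> ->].
Qed.

Lemma small_pow T : small T -> small (set T).
Proof.
move=> [s [f fi]]; have [p pP] := @zfc_power V s.
pose im (A : set T) := vset [set z | exists2 t, A t & z = \val (f t)].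
have imE A z : z ∈ im A <-> exists2 t, A t & z = \val (f t).
  by apply: (vset_sub (x := s)) => y [t _ ->]; exact: elP.
have imp A : im A ∈ p by apply/pP => z /imE[t _ ->]; exact: elP.
have sub A B : im A = im B -> A `<=` B.
  move=> e t At; have : \val (f t) ∈ im A by apply/imE; exists t.
  by rewrite e => /imE[u Bu] /el_inj/fi ->.
exists p; exists (fun A => elm (imp A)) => A B /(congr1 val) /= e.
by apply/seteqP; split; exact: sub.
Qed.

Lemma small_fun T U : small T -> small U -> small (T -> U).
Proof.
move=> sT sU; have := small_pow (small_prod sT sU); apply: small_embeds.
exists (fun f => [set p | p.2 = f p.1]) => f g fg; apply/funext => t.
by have : [set p | p.2 = f p.1] (t, f t) by []; rewrite fg.
Qed.

(** The successors are found in an inductive set, where the axiom of infinity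
    provides them. *)
Lemma vnat_aux : exists w, forall n, vnat V n ∈ w /\
  forall z, z ∈ vnat V n <-> exists2 k, (k < n)%N & z = vnat V k.
Proof.
have [w [[e [ew e0]] sw]] := @zfc_infinity V.
have E z : z ∈ vnat V 0 <-> False.
  by apply: (vsetE (P := set0)); exists e => x; split=> // /e0.
exists w; elim=> [|n [nw nP]].
  split=> [|z]; last by rewrite E; split=> // -[].
  by rewrite (_ : vnat V 0 = e) //; apply: zfc_ext => z; rewrite E; split=> // /e0.
have [s [sw' sP]] := sw _ nw.
have E' z : z ∈ vnat V n.+1 <-> z ∈ vnat V n \/ z = vnat V n.
  by apply: (vsetE (P := [set z | z ∈ vnat V n \/ z = vnat V n])); exists s.
split.
  rewrite (_ : vnat V n.+1 = s) //; apply: zfc_ext => z.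
  by rewrite sP E'.
move=> z; rewrite E' nP; split.
  by move=> [[k kn ->]|->]; [exists k => //; exact: ltnW|exists n].
move=> [k]; rewrite ltnS leq_eqVlt => /orP[/eqP->|kn ->]; first by right.
by left; exists k.
Qed.

Lemma vnatP n z : z ∈ vnat V n <-> exists2 k, (k < n)%N & z = vnat V k.
Proof. by have [w /(_ n)[]] := vnat_aux. Qed.

Lemma vnat_inj : injective (vnat V).
Proof.
move=> m n e; apply/eqP; case: ltngtP => // mn; exfalso.
  by apply: (@vnonself (vnat V n)); apply/vnatP; exists m.
by apply: (@vnonself (vnat V m)); apply/vnatP; exists n.
Qed.

Lemma small_nat : small nat.
Proof.
have [w wP] := vnat_aux; exists w.
by exists (fun n => elm (wP n).1) => m n /(congr1 val) /vnat_inj.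
Qed.

Lemma small_count (T : countType) : small T.
Proof.
by apply: small_embeds small_nat; exists pickle; exact: (pcan_inj pickleK).
Qed.

Lemma small_sum T U : small T -> small U -> small (T + U).
Proof.
(* A subset of each summand, rather than an element, needs no default value. *)
move=> sT sU; have := small_prod (small_count bool)
  (small_prod (small_pow sT) (small_pow sU)).
apply: small_embeds; exists (fun p => match p with
  inl a => (true, ([set a], set0)) | inr a => (false, (set0, [set a])) end).
move=> [a|a] [b|b] // [] e; congr (_ _); have : [set a] a by [].
  by rewrite e.
by rewrite e.
Qed.

End Sets.

(** * Ordinals and cardinals *)

Lemma strict_well_order (T : eqType) : exists R : T -> T -> Prop,
  [/\ well_founded R, forall x y z, R x y -> R y z -> R x z &
      forall x y, x <> y -> R x y \/ R y x].
Proof.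
have [R wo] := wochoice.well_ordering_principle T.
have min (P : set T) x : P x -> exists2 m, P m & forall y, P y -> R m y.
  move=> Px; have [|m [[mP mb] _]] := wo [pred y | `[< P y >]].
    by exists x; exact/asboolP.
  by exists m => [|y Py]; [exact/asboolP|apply: mb; exact/asboolP].
have tot x y : R x y \/ R y x.
  have [m] := min [set z | z = x \/ z = y] x (or_introl erefl).
  by move=> [->|->] mle; [left|right]; apply: mle; [right|left].
have anti x y : R x y -> R y x -> x = y.
  move=> xy yx; have [|m [_ mu]] := wo (pred2 x y).
    by exists x; rewrite !inE eqxx.
  have xx : R x x by case: (tot x x).
  have yy : R y y by case: (tot y y).
  by rewrite -(mu x) 1?(mu y) //; split; rewrite ?inE ?eqxx ?orbT // => z;
     rewrite inE => /orP[] /eqP ->.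
exists (fun x y => R x y /\ x <> y); split.
- move=> x; apply: contrapT => nx.
  have [m nm mm] := min [set x | ~ Acc (fun x y => R x y /\ x <> y) x] x nx.
  apply: nm; constructor=> y [ym ynm]; apply: contrapT => /mm my.
  by apply: ynm; exact: anti.
- move=> x y z [xy nxy] [yz nyz].
  have [m] := min [set t | t = x \/ t = y \/ t = z] x (or_introl erefl).
  have xz : R x z -> R x z /\ x <> z.
    by move=> h; split=> // e; subst z; apply: nxy; exact: anti.
  case=> [->|[->|->]] mm; first by apply: xz; apply: mm; right; right.
    by case: nxy; apply: anti => //; apply: mm; left.
  by case: nyz; apply: anti => //; apply: mm; right; left.
- move=> x y nxy; case: (tot x y) => h; [left|right]; split=> //.
  by move=> e; exact/nxy.
Qed.

Section Ordinals.
Variable V : zfc.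
Implicit Types (x y z s : V) (P : set V).

Lemma ord_el x y : ordinal x -> y ∈ x -> ordinal y.
Proof.
move=> [tx ex] yx; split; first exact: ex.
by move=> z zy; apply: ex; exact: tx zy.
Qed.

Lemma ord_trans x y z : ordinal x -> z ∈ y -> y ∈ x -> z ∈ x.
Proof. by move=> [tx _] zy yx; exact: tx zy. Qed.

Lemma ord_min P : (forall x, P x -> ordinal x) -> (exists x, P x) ->
  exists2 x, P x & forall y, y ∈ x -> ~ P y.
Proof.
move=> Po [x Px]; have [ex|nex] := pselect (exists y, y ∈ x /\ P y); last first.
  by exists x => // y yx Py; apply: nex; exists y.
have [s sP] := v_sep x P; have [|y [/sP[yx Py] ym]] := @zfc_foundation V s.
  by move: ex => [y yP]; exists y; exact/sP.
exists y => // z zy Pz; apply: (ym z) => //; apply/sP; split=> //.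
exact: ord_trans (Po _ Px) zy yx.
Qed.

(** Minimal incomparable ordinals have the same elements. *)
Lemma ord_total x y : ordinal x -> ordinal y -> [\/ x ∈ y, x = y | y ∈ x].
Proof.
pose cmp x y := [\/ x ∈ y, x = y | y ∈ x].
move=> ox oy; apply: contrapT => nxy.
have [|x0 [ox0 [y1 oy1 nxy1]] xm] := @ord_min
    [set x | ordinal x /\ exists2 y, ordinal y & ~ cmp x y] (fun x h => h.1).
  by exists x; split=> //; exists y.
have [||y0 [oy0 nxy0] ym] := @ord_min [set y | ordinal y /\ ~ cmp x0 y].
- by move=> z [].
- by exists y1.
suff e : x0 = y0 by apply: nxy0; rewrite e; constructor 2.
apply: zfc_ext => z; split=> [zx|zy].
  have oz := ord_el ox0 zx.
  have : cmp z y0.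
    by apply: contrapT => h; apply: (xm _ zx); split=> //; exists y0.
  case=> // [zy|yz]; exfalso; apply: nxy0; constructor 3; first by rewrite -zy.
  exact: ord_trans yz zx.
have oz := ord_el oy0 zy.
have : cmp x0 z by apply: contrapT => h; apply: (ym _ zy); split.
case=> // [xz|xz]; exfalso; apply: nxy0; constructor 1; last by rewrite xz.
exact: ord_trans xz zy.
Qed.

Lemma ord_sub x y : ordinal x -> ordinal y -> y = x \/ y ∈ x -> vsub y x.
Proof. by move=> ox oy [->//|yx z zy]; exact: ord_trans yx. Qed.

Lemma ord_mem_wf x : ordinal x -> well_founded (fun a b : El x => \val a ∈ \val b).
Proof.
move=> ox a; apply: contrapT => na.
pose bad z := exists2 b : El x, z = \val b &
  ~ Acc (fun a b : El x => \val a ∈ \val b) b.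
have [||z [b zb nb] zm] := @ord_min bad.
- by move=> _ [b -> _]; apply: ord_el ox _; exact: elP.
- by exists (\val a); exists a.
apply: nb; constructor=> c cb; apply: contrapT => nc.
by apply: (zm (\val c)); [rewrite zb|exists c].
Qed.

(** The value of [f] at [i] is the set of its values below [i]: the collapse of
    Mostowski. *)
Lemma collapse (T : Type) (R : T -> T -> Prop) : small V T ->
  well_founded R -> (forall i j k, R i j -> R j k -> R i k) ->
  (forall i j, i <> j -> R i j \/ R j i) ->
  exists a, ordinal a /\ exists f : T -> V, [/\ injective f,
    forall i z, z ∈ f i <-> exists j, R j i /\ z = f j &
    forall z, z ∈ a <-> exists i, z = f i].
Proof.
move=> sT wf tr tot.
pose F (x : T) (rec : forall y : T, R y x -> V) : V :=
  vset [set z | exists (y : T) (h : R y x), z = rec y h].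
pose f := Fix wf (fun=> V : Type) F.
have fE (x : T) z : z ∈ f x <-> exists y : T, R y x /\ z = f y.
  rewrite /f Fix_eq; last first.
    move=> y g h gh; congr F; apply: functional_extensionality_dep => u.
    by apply: functional_extensionality_dep => p; exact: gh.
  rewrite {1}/F (vset_smallE (T := {y : T | R y x}) (f := fun p => f (sval p))).
  - by split=> [[y [h ->]]|[y [h ->]]]; exists y => //; exists h.
  - apply: small_embeds sT; exists sval => -[u p] [v q] /= e; subst v.
    by congr exist; exact: Prop_irrelevance.
  - move=> t; split=> [[y [h ->]]|[[y h] ->]]; first by exists (exist _ y h).
    by exists y, h.
have irr (x : T) : ~ R x x.
  by elim/(well_founded_ind wf): x => i IH ii; exact: (IH _ ii ii).
have mono (x y : T) : R x y -> f x ∈ f y by move=> xy; apply/fE; exists x.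
have finj : injective f.
  move=> x y e; apply: contrapT => /tot[] /mono; rewrite e; exact: vnonself.
have ftr (x : T) : transitive_set (f x).
  move=> y /fE[u [ux ->]] z /fE[v [vu ->]]; apply/fE; exists v; split=> //.
  exact: tr ux.
have [a aP] := small_range f sT.
exists a; split; last by exists f; split.
split=> [y /aP[x ->] z /fE[u [_ ->]]|y /aP[x ->]//].
by apply/aP; exists u.
Qed.

Lemma small_ord T : small V T ->
  exists2 a : V, ordinal a & [set: T] #= [set: El a].
Proof.
move=> [s [g gi]]; have [R [wf tr tot]] := strict_well_order (El s).
have [||||a [oa [f [fi fE aP]]]] := @collapse T (fun i j => R (g i) (g j)).
- by exists s, g.
- exact: (wf_inverse_image _ _ _ _ wf).
- by move=> x y z; exact: tr.
- by move=> x y xy; apply: tot => /gi.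
exists a => //.
have fa t : f t ∈ a by apply/aP; exists t.
apply: embeds_antisym; first by exists (fun t => elm (fa t)) => i j /(congr1 val)/fi.
apply: (embeds_surj (f := fun t => elm (fa t))) => z; have /aP[x e] := elP z.
by exists x; apply: el_inj.
Qed.

(** The least ordinal in bijection with [T] is a cardinal. *)
Lemma card_ofP T : small V T ->
  cardinal (card_of V T) /\ [set: T] #= [set: El (card_of V T)].
Proof.
move=> sT; rewrite /card_of; case: xgetP => // h; exfalso.
have [||c [oc Tc] cm] := @ord_min [set a | ordinal a /\ [set: T] #= [set: El a]].
- by move=> x [].
- by have [a oa Ta] := small_ord sT; exists a.
apply: (h c); split=> //; split=> // y yc yc'.
apply: (cm _ yc); split; first exact: ord_el oc yc.
by apply: card_eq_trans Tc _; rewrite card_eq_sym.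
Qed.

End Ordinals.

(** * Comparison of cardinals and squares *)

Section Cardinals.
Variable V : zfc.
Implicit Types (x y z s c d : V) (P : set V).

Lemma card_of_bij T : small V T ->
  embeds T (El (card_of V T)) /\ embeds (El (card_of V T)) T.
Proof.
move=> /card_ofP[_ Tc]; split; first exact: card_eq_embeds.
by apply: card_eq_embeds; rewrite card_eq_sym.
Qed.

Lemma card_of_cardinal T : small V T -> cardinal (card_of V T).
Proof. by case/card_ofP. Qed.

Lemma cardinal_notin c y : cardinal c -> y ∈ c -> ~ embeds (El c) (El y).
Proof.
move=> [oc cmin] yc cy; apply: (cmin _ yc); apply: embeds_antisym => //.
by apply: el_sub; apply: ord_sub => //; [exact: ord_el yc|right].
Qed.

Lemma ord_lt_cardinal c y : cardinal c -> ordinal y ->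
  (y ∈ c <-> ~ embeds (El c) (El y)).
Proof.
move=> cc oy; split; first exact: cardinal_notin.
have oc : ordinal c by case: cc.
case: (ord_total oc oy) => // [cy|cy] []; apply: el_sub; apply: ord_sub => //.
  by right.
by left.
Qed.

Lemma card_of_lt c T : cardinal c -> small V T ->
  (card_of V T ∈ c <-> ~ embeds (El c) T).
Proof.
move=> cc sT; have [Tc cT] := card_of_bij sT.
rewrite ord_lt_cardinal //; last by case: (card_of_cardinal sT).
by split=> h e; apply: h; apply: embeds_trans e _.
Qed.

Lemma cardinal_card c : cardinal c -> vcard c = c.
Proof.
move=> cc; have sc := small_El c; have [cT Tc] := card_of_bij sc.
have cv := card_of_cardinal sc; rewrite /vcard.
by case: (ord_total (proj1 cv) (proj1 cc)) => // h; exfalso;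
   [apply: cardinal_notin h cT|apply: cardinal_notin h Tc].
Qed.

Lemma embeds_total T U : small V T -> small V U -> embeds T U \/ embeds U T.
Proof.
move=> sT sU; have [a oa Ta] := small_ord sT; have [b ob Ub] := small_ord sU.
have [aT Ta'] : embeds (El a) T /\ embeds T (El a).
  by split; apply: card_eq_embeds => //; rewrite card_eq_sym.
have [bU Ub'] : embeds (El b) U /\ embeds U (El b).
  by split; apply: card_eq_embeds => //; rewrite card_eq_sym.
have : embeds (El a) (El b) \/ embeds (El b) (El a).
  by case: (ord_total oa ob) => h; [left|left|right]; apply: el_sub;
     apply: ord_sub => //; auto.
case=> h; [left|right]; first exact: embeds_trans Ta' (embeds_trans h bU).
exact: embeds_trans Ub' (embeds_trans h aT).
Qed.

Lemma cantor T : ~ embeds (set T) T.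
Proof.
move=> [f fi]; pose D := [set t | exists2 A, t = f A & ~ A t].
have [DD|nDD] := pselect (D (f D)).
  by case: (DD) => A /fi <-; apply.
by apply: (nDD); exists D.
Qed.

(** By Cantor's theorem the power set of [x] bounds a cardinal above [x]; the
    least one is the successor. *)
Lemma succ_cardP x : cardinal x ->
  [/\ cardinal (succ_card x), x ∈ succ_card x &
      forall T, small V T -> (card_of V T ∈ succ_card x <-> embeds T (El x))].
Proof.
move=> cx; have sx := small_El x.
have [cs xs sm] : [/\ cardinal (succ_card x), x ∈ succ_card x &
    forall d, cardinal d -> x ∈ d -> succ_card x = d \/ succ_card x ∈ d].
  rewrite /succ_card; case: xgetP => // h; exfalso.
  have [||c [cc xc] cm] := @ord_min V [set c | cardinal c /\ x ∈ c].
  - by move=> c [[]].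
  - exists (card_of V (set (El x))); split.
      by apply: card_of_cardinal; exact: small_pow.
    suff : vcard x ∈ card_of V (set (El x)) by rewrite cardinal_card.
    apply/(card_of_lt (card_of_cardinal (small_pow sx)) sx).
    move=> e; apply: (@cantor (El x)); apply: embeds_trans e.
    by have [] := card_of_bij (small_pow sx).
  apply: (h c); split=> // d dd xd.
  by case: (ord_total (proj1 cc) (proj1 dd)) => [h'|->|/cm[]]; [right|left|].
split=> // T sT; have [Tc cT] := card_of_bij sT.
have ccT := card_of_cardinal sT; split=> [Tx|Tx]; last first.
  apply/(card_of_lt cs sT) => /embeds_trans /(_ Tx); exact: cardinal_notin.
case: (ord_total (proj1 ccT) (proj1 cx)) => h.
- apply: embeds_trans Tc _; apply: el_sub; apply: ord_sub; auto.
  - by case: cx.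
  - by case: ccT.
- by move: Tc; rewrite h.
exfalso; case: (sm _ ccT h) => [e|h'].
  by apply: (@vnonself V (card_of V T)); rewrite -{2}e.
exact: vnocycle Tx h'.
Qed.

Lemma infinite_embeds T : infinite_set [set: T] <-> embeds nat T.
Proof. by rewrite infiniteP embedsP. Qed.

Lemma embeds_nat_prod T U : embeds nat (T * U) -> embeds nat T \/ embeds nat U.
Proof.
move=> /infinite_embeds; rewrite -setXTT => TU.
have [fT|/infinite_embeds] := pselect (finite_set [set: T]); last by left.
have [fU|/infinite_embeds] := pselect (finite_set [set: U]); last by right.
by case: TU; exact: finite_setX.
Qed.

Lemma embeds_nat_option T : embeds nat (option T) -> embeds nat T.
Proof.
move=> /infinite_embeds oT; apply/infinite_embeds => fT; apply: oT.
rewrite (_ : [set: option T] = [set None] `|` some @` [set: T]); last first.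
  by apply/seteqP; split=> [[t|]|] // _; [right; exists t|left].
by rewrite finite_setU; split; [exact: finite_set1|exact: finite_image].
Qed.

(** A copy of [nat] in [T] is shifted to make room for one element. *)
Lemma embeds_option T : embeds nat T -> embeds (option T) T.
Proof.
move=> [f fi].
pose g t := if pselect (exists n, t = f n) is left e then f (projT1 (cid e)).+1 else t.
have gE n : g (f n) = f n.+1.
  rewrite /g; case: pselect => [e|[]]; last by exists n.
  by case: cid => m /= /fi ->.
have g0 t : f 0%N <> g t.
  rewrite /g; case: pselect => [e|ne]; first by move=> /fi.
  by move=> e; apply: ne; exists 0%N.
have gi : injective g.
  move=> t u; rewrite {1 2}/g; case: pselect => [e|ne]; case: pselect => [e'|ne'] //.
  - by case: cid => m tm; case: cid => n un /= /fi [mn]; rewrite tm un mn.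
  - by move=> h; case: ne'; rewrite -h; eexists.
  - by move=> h; case: ne; rewrite h; eexists.
exists (fun o => if o is Some t then g t else f 0%N) => -[t|] [u|] //.
- by move=> /gi ->.
- by move=> /esym/g0.
- by move=> /g0.
Qed.

(** Let [c] be the least infinite cardinal that fails. Order its pairs by their
    maximum, ties being broken by any well-order. The pairs below a given one
    belong to the square of a proper initial segment of [c], so that by
    minimality there are less than [c] of them. Hence the order type is at most
    [c]. *)
Lemma hessenberg T : small V T -> embeds nat T -> embeds (T * T) T.
Proof.
pose C : set V := [set c | [/\ cardinal c, embeds nat (El c) &
  ~ embeds (El c * El c) (El c)]].
suff C0 c : ~ C c.
  move=> sT nT; have [Tc cT] := card_of_bij sT.
  have h : embeds (El (card_of V T) * El (card_of V T)) (El (card_of V T)).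
    apply: contrapT => h; apply: (C0 (card_of V T)); split=> //.
      exact: card_of_cardinal.
    exact: embeds_trans Tc.
  exact: embeds_trans (embeds_prod Tc Tc) (embeds_trans h cT).
move=> Cc; have [|{Cc}{}c [cc nc ncc] cm] := @ord_min V C _ (ex_intro _ c Cc).
  by move=> d [[]].
have oc : ordinal c by case: cc.
pose rk (p : El c * El c) := if `[< \val p.1 ∈ \val p.2 >] then p.2 else p.1.
have [R0 [wf0 tr0 tot0]] := strict_well_order (El c * El c)%type.
pose R p q := \val (rk p) ∈ \val (rk q) \/ rk p = rk q /\ R0 p q.
have oe (a : El c) : ordinal (\val a) by apply: ord_el oc _; exact: elP.
have sc := small_El c.
have [||||a [oa [f [fi fE aP]]]] := @collapse V (El c * El c)%type R.
- exact: small_prod.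
- suff wf r : forall p, rk p = r -> Acc R p by move=> p; exact: wf erefl.
  elim/(well_founded_ind (ord_mem_wf oc)): r => r IH p.
  elim/(well_founded_ind wf0): p => p IHp pr; constructor=> q [qp|[qp Rqp]].
    by apply: IH erefl; rewrite -pr.
  by apply: IHp => //; rewrite qp.
- move=> p q r [pq|[pq Rpq]] [qr|[qr Rqr]].
  + by left; exact: ord_trans pq qr.
  + by left; rewrite -qr.
  + by left; rewrite pq.
  + by right; split; [rewrite pq|exact: tr0 Rqr].
- move=> p q pq.
  case: (ord_total (oe (rk p)) (oe (rk q))) => [h|/el_inj h|h].
  + by left; left.
  + by case: (tot0 _ _ pq) => h'; [left|right]; right.
  + by right; left.
apply: ncc; have fa p : f p ∈ a by apply/aP; exists p.
apply: (@embeds_trans _ (El a)).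
  by exists (fun p => elm (fa p)) => p q /(congr1 val)/fi.
case: (ord_total oa oc) => [h|h|h].
- by apply: el_sub; apply: ord_sub => //; right.
- by apply: el_sub; apply: ord_sub => //; left.
(* Now [c] is the collapse of the pairs below some [p]. *)
exfalso; have [p cp] := (aP c).1 h.
pose S := {z : El c | \val z ∈ \val (rk p) \/ z = rk p}.
have sS : small V S by apply: small_embeds sc; exists sval => -[u pu] [v pv] /= e;
  subst v; congr exist; exact: Prop_irrelevance.
have cSS : embeds (El c) (S * S).
  have inS (q : El c * El c) : R q p ->
      (\val q.1 ∈ \val (rk p) \/ q.1 = rk p) /\
      (\val q.2 ∈ \val (rk p) \/ q.2 = rk p).
    have rq : R q p -> \val (rk q) ∈ \val (rk p) \/ rk q = rk p.
      by case=> [|[]]; auto.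
    move=> /rq; rewrite /rk.
    have tr (u v : El c) w : \val u ∈ \val v -> \val v ∈ \val w \/ v = w ->
        \val u ∈ \val w \/ u = w.
      by move=> uv [vw|<-]; left => //; exact: ord_trans uv vw.
    case: asboolP => [h12|n12] h'; split=> //; first exact: tr h12 h'.
    case: (ord_total (oe q.1) (oe q.2)) => // [/el_inj <-//|h21].
    exact: tr h21 h'.
  apply: (embeds_rel (F := fun (u : S * S) (z : El c) =>
      \val z = f (sval u.1, sval u.2))).
    move=> z; have /fE[q [Rqp zq]] :=
      eq_ind c (fun y => (\val z : V) ∈ y) (elP z) _ cp.
    have [h1 h2] := inS _ Rqp.
    by exists (exist _ q.1 h1 : S, exist _ q.2 h2 : S); rewrite zq -surjective_pairing.
  by move=> u z z' <- /el_inj.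
have nS : embeds nat S.
  by case: (embeds_nat_prod (embeds_trans nc cSS)).
have [Sm mS] := card_of_bij sS; have cm' := card_of_cardinal sS.
set m := card_of V S in Sm mS cm'.
have mc : m ∈ c.
  apply/(card_of_lt cc sS) => cS.
  have So : embeds S (option (El (\val (rk p)))).
    exists (fun z : S => match pselect (\val (sval z) ∈ \val (rk p)) with
       left h => Some (elm h) | right _ => None end).
    move=> [u hu] [v hv] /=; case: pselect => h1; case: pselect => h2 //.
      move=> [] /el_inj e; subst v; congr exist; exact: Prop_irrelevance.
    case: hu h1 => // e1 _; case: hv h2 => // e2 _ _; subst u v.
    by congr exist; exact: Prop_irrelevance.
  apply: (cardinal_notin cc (elP (rk p))); apply: embeds_trans cS _.
  apply: (embeds_trans So); apply: embeds_option; apply: embeds_nat_option.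
  exact: embeds_trans nS So.
apply: (@cardinal_notin c m) => //; apply: embeds_trans cSS _.
apply: embeds_trans (embeds_prod Sm Sm) _; apply: contrapT => h'.
by apply: (cm _ mc); split=> //; exact: embeds_trans nS Sm.
Qed.

End Cardinals.

(** * Regular cardinals *)

Lemma embeds_sigma T I (U : I -> Type) :
  embeds (T * T) T -> embeds I T -> (forall i, embeds (U i) T) ->
  embeds {i : I & U i} T.
Proof.
move=> TT IT UT; apply: embeds_trans TT; have [f fi] := IT.
pose g i := projT1 (cid (UT i)).
have gi i : injective (g i) := projT2 (cid (UT i)).
exists (fun p => (f (tag p), g (tag p) (tagged p))) => -[i a] [j b] /= [/fi ij].
by subst j => /gi ->.
Qed.

Lemma embeds_absorb_prod T U W :
  embeds (T * T) T -> embeds U T -> embeds W T -> embeds (U * W) T.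
Proof. by move=> TT UT WT; apply: embeds_trans TT; exact: embeds_prod. Qed.

Lemma embeds_absorb_sum T U W : embeds nat T ->
  embeds (T * T) T -> embeds U T -> embeds W T -> embeds (U + W) T.
Proof.
move=> [h hi] TT [f fi] [g gi]; apply: embeds_trans TT.
exists (fun p => match p with inl a => (h 0%N, f a) | inr a => (h 1%N, g a) end).
by move=> [a|a] [b|b] //= [] => [/fi->|/hi|/hi|/gi->].
Qed.

Lemma embeds_absorb_seq T U : embeds nat T -> embeds (T * T) T ->
  embeds U T -> embeds (seq U) T.
Proof.
move=> nT TT [g gi]; have [h hi] := TT; have [n _] := nT.
apply: (@embeds_trans _ (nat * T)); last first.
  by apply: (@embeds_absorb_prod T) => //; exact: embeds_refl.
pose code := foldr (fun u t => h (g u, t)) (n 0%N).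
exists (fun s => (size s, code s)) => s t [].
by elim: s t => [|u s IH] [|v t] //= [] /IH {}IH /hi[/gi -> /IH ->].
Qed.

Lemma embeds_set_bool T : embeds (set T) (T -> bool).
Proof.
exists (fun A t => `[< A t >]) => A B AB; apply/seteqP; split=> t At.
  by apply/asboolP; rewrite -(congr1 (@^~ t) AB); exact/asboolP.
by apply/asboolP; rewrite (congr1 (@^~ t) AB); exact/asboolP.
Qed.

Section Regular.
Variable V : zfc.
Implicit Types (x y z s c d lambda : V) (P : set V).

Lemma succ_card_el x y : cardinal x -> y ∈ succ_card x -> embeds (El y) (El x).
Proof.
move=> cx ys; have [cs xs sP] := succ_cardP cx; have sy := small_El y.
apply/sP => //; apply/(card_of_lt cs sy); exact: cardinal_notin.
Qed.

(** A set [s] of less than [succ_card x] ordinals below [succ_card x] is bounded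
    by the union of their successors, which has size at most [x] as a union of
    at most [x] sets of size at most [x]. *)
Lemma succ_card_regular x : cardinal x -> embeds nat (El x) ->
  regular (succ_card x).
Proof.
move=> cx nx; have [cs xs sP] := succ_cardP cx; have os : ordinal (succ_card x) by case: cs.
have xx := hessenberg (small_El x) nx.
split=> //.
  apply/infinite_embeds; apply: embeds_trans nx _.
  by apply: el_sub; apply: ord_sub => //; [case: cx|right].
move=> s sub /(sP _ (small_El s)) sx.
have [b bP] := v_sep (succ_card x) [set z | exists2 y, y ∈ s & z ∈ y \/ z = y].
have ob : ordinal b.
  split=> [z /bP[zs [y ys zy]] t tz|z /bP[zs _]]; last by case: (ord_el os zs).
  have tS := ord_trans os tz zs; apply/bP; split=> //; exists y => //; left.
  case: zy => [zy|<-] //; apply: ord_trans tz zy; exact: ord_el os (sub _ ys).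
exists b; last by move=> y ys; apply/bP; split; [exact: sub|exists y => //; right].
apply/(ord_lt_cardinal cs ob) => sb; apply: (cardinal_notin cs xs).
apply: embeds_trans sb _.
have h : embeds {y : El s & option (El (\val y))} (El x).
  apply: embeds_sigma => // y; have yx := succ_card_el cx (sub _ (elP y)).
  by apply: embeds_trans (embeds_option nx); have [f fi] := yx;
     exists (omap f) => -[u|] [v|] //= [/fi ->].
apply: embeds_trans h.
apply: (embeds_rel (F := fun (u : {y : El s & option (El (\val y))}) (z : El b) =>
   \val z = if tagged u is Some t then \val t else \val (tag u))).
  move=> z; have /bP[_ [y ys [zy|zy]]] := elP z.
    by exists (existT (fun y : El s => option (El (\val y))) (elm ys) (Some (elm zy : El (\val (elm ys))))).
  by exists (existT (fun y : El s => option (El (\val y))) (elm ys) None).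
by move=> u z z' <- /el_inj.
Qed.

(** |T| < lambda; contrary to [card_of V T ∈ lambda], this entails that [T] is
    small. *)
Definition below lambda T := exists2 m, m ∈ lambda & embeds T (El m).

Section Lambda.
Variables (lambda theta : V).
Hypotheses (lreg : regular lambda) (ctheta : cardinal theta)
  (ntheta : embeds nat (El theta))
  (lexp : forall mu, cardinal mu -> mu ∈ lambda ->
     card_of V (El theta -> El mu) ∈ lambda).

Let lcard : cardinal lambda. Proof. by case: lreg. Qed.
Let lord : ordinal lambda. Proof. by case: lcard. Qed.

Lemma belowP T : below lambda T <-> small V T /\ ~ embeds (El lambda) T.
Proof.
split=> [[m ml Tm]|[sT Tl]].
  split; first exact: small_embeds Tm (small_El m).
  by move=> /embeds_trans/(_ Tm); exact: cardinal_notin.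
by exists (card_of V T); [exact/card_of_lt|have [] := card_of_bij sT].
Qed.

Lemma below_small T : below lambda T -> small V T. Proof. by case/belowP. Qed.

Lemma smaller_thanE x : smaller_than lambda x <-> below lambda (El x).
Proof.
rewrite /smaller_than /= /vcard belowP card_of_lt //; last exact: small_El.
by split=> [|[]]; [split=> //; exact: small_El|].
Qed.

Lemma below_embeds T U : embeds T U -> below lambda U -> below lambda T.
Proof. by move=> TU [m ml Um]; exists m => //; exact: embeds_trans Um. Qed.

Lemma below_card T : below lambda T -> card_of V T ∈ lambda.
Proof. by move=> /belowP[sT Tl]; apply/card_of_lt. Qed.

Lemma below_fun T : below lambda T -> below lambda (El theta -> T).
Proof.
move=> lT; have sT := below_small lT; have [Tc _] := card_of_bij sT.
exists (card_of V (El theta -> El (card_of V T))).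
  by apply: lexp; [exact: card_of_cardinal|exact: below_card].
apply: embeds_trans (embeds_fun _ Tc) _.
by have [] := card_of_bij (small_fun (small_El theta) (small_El (card_of V T))).
Qed.

Lemma below_theta_pow : below lambda (El theta -> bool).
Proof.
apply: below_fun; apply/belowP; split; first exact: small_count.
move=> h; have [_ /infinite_embeds nl _] := lreg.
have /infinite_embeds[] := embeds_trans nl h.
exact: finite_finset.
Qed.

Lemma below_theta : below lambda (El theta).
Proof.
apply: below_embeds below_theta_pow; exists (fun a b => a == b) => a b.
by move=> /(congr1 (@^~ a)); rewrite eqxx => /esym/eqP.
Qed.

(** Bounding two types by one infinite cardinal reduces their sum and their
    product to its square. *)
Lemma below_sup T U : below lambda T -> below lambda U ->
  exists m, [/\ m ∈ lambda, embeds T (El m), embeds U (El m) &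
                embeds nat (El m) /\ embeds (El m * El m) (El m)].
Proof.
have sup a b : a ∈ lambda -> b ∈ lambda -> exists2 m, m ∈ lambda &
    embeds (El a) (El m) /\ embeds (El b) (El m).
  move=> al bl; have oa := ord_el lord al; have ob := ord_el lord bl.
  case: (ord_total oa ob) => h; [exists b => //|exists a => //|exists a => //];
    split; try exact: embeds_refl; apply: el_sub; apply: ord_sub => //; auto.
move=> [a al Ta] [b bl Ub]; have [t tl tt] := below_theta.
have [m ml [am bm]] := sup _ _ al bl; have [n nl [mn tn]] := sup _ _ ml tl.
have nn : embeds nat (El n).
  exact: embeds_trans ntheta (embeds_trans tt tn).
exists n; split=> //; last by split=> //; exact: hessenberg (small_El n) nn.
- exact: embeds_trans Ta (embeds_trans am mn).
- exact: embeds_trans Ub (embeds_trans bm mn).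
Qed.

Lemma below_prod T U : below lambda T -> below lambda U -> below lambda (T * U).
Proof.
move=> lT lU; have [m [ml Tm Um [nm mm]]] := below_sup lT lU.
by exists m => //; exact: embeds_absorb_prod.
Qed.

Lemma below_sum T U : below lambda T -> below lambda U -> below lambda (T + U).
Proof.
move=> lT lU; have [m [ml Tm Um [nm mm]]] := below_sup lT lU.
by exists m => //; exact: embeds_absorb_sum.
Qed.

(** Regularity bounds the sizes of all the summands at once. *)
Lemma below_sigma I (U : I -> Type) : below lambda I -> (forall i, below lambda (U i)) ->
  below lambda {i : I & U i}.
Proof.
move=> lI lU; have [s sP] := small_range (fun i => card_of V (U i)) (below_small lI).
have [_ _ /(_ s)[]] := lreg.
- by move=> z /sP[i ->]; exact: below_card.
- apply/smaller_thanE; apply: below_embeds lI.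
  apply: (embeds_rel (F := fun i (z : El s) => \val z = card_of V (U i))).
    by move=> z; have /sP := elP z.
  by move=> i z z' <- /el_inj.
move=> b bl bP; have lb : below lambda (El b) by exists b => //; exact: embeds_refl.
have [m [ml Im bm [_ mm]]] := below_sup lI lb; exists m => //.
apply: embeds_sigma => // i; have [Uc _] := card_of_bij (below_small (lU i)).
apply: embeds_trans Uc (embeds_trans _ bm); apply: el_sub.
apply: ord_sub; [exact: ord_el bl| |].
  by case: (card_of_cardinal (below_small (lU i))).
by right; apply: bP; apply/sP; exists i.
Qed.

(** theta^+ is at most 2^theta. *)
Lemma below_succ_theta : below lambda (El (succ_card theta)).
Proof.
apply: below_embeds below_theta_pow; have [cs _ sP] := succ_cardP ctheta.
have sp : small V (El theta -> bool).
  by apply: small_fun (small_El _) (small_count _ _).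
have [pc cp] := card_of_bij sp; have cc := card_of_cardinal sp.
apply: embeds_trans cp; apply: el_sub; apply: ord_sub => //; try by case: cc.
  by case: cs.
case: (ord_total (proj1 cs) (proj1 cc)); [by right|by left|].
move=> /(sP _ sp) /(embeds_trans (@embeds_set_bool _)) /cantor [].
Qed.

End Lambda.
End Regular.

(** * Closed elementary submodels *)

Fixpoint formula_tree (p : formula) : GenTree.tree nat :=
  match p with
  | FEq i j => GenTree.Node 0 [:: GenTree.Leaf i; GenTree.Leaf j]
  | FIn i j => GenTree.Node 1 [:: GenTree.Leaf i; GenTree.Leaf j]
  | FNot q => GenTree.Node 2 [:: formula_tree q]
  | FAnd q r => GenTree.Node 3 [:: formula_tree q; formula_tree r]
  | FEx i q => GenTree.Node 4 [:: GenTree.Leaf i; formula_tree q]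
  end.

Lemma formula_countable : embeds formula nat.
Proof.
apply: (@embeds_trans _ (GenTree.tree nat)).
  exists formula_tree; elim=> [i j|i j|p IHp|p IHp q IHq|i p IHp]
    [i' j'|i' j'|p'|p' q'|i' p'] //=; [move=> [-> ->]|move=> [-> ->]|
    move=> [/IHp->]|move=> [/IHp-> /IHq->]|move=> [-> /IHp->]] => //.
by exists pickle; exact: (pcan_inj pickleK).
Qed.

Section Hull.
Variable V : zfc.
Implicit Types (x y z s c d : V) (P X : set V).

Definition upd (e : nat -> V) i x : nat -> V := fun j => if j == i then x else e j.

Definition members X : Type := {z : V | X z}.

Lemma members_inj X : injective (fun u : members X => sval u).
Proof. by move=> [a p] [b q] /= e; subst b; congr exist; exact: Prop_irrelevance. Qed.

Variables (lambda theta : V).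
Hypotheses (lreg : regular lambda) (ctheta : cardinal theta)
  (ntheta : embeds nat (El theta))
  (lexp : forall mu, cardinal mu -> mu ∈ lambda ->
     card_of V (El theta -> El mu) ∈ lambda).

Let lcard : cardinal lambda. Proof. by case: lreg. Qed.
Let lord : ordinal lambda. Proof. by case: lcard. Qed.

Definition sup_of X : V := get [set d | d ∈ lambda /\
  forall y, X y -> y ∈ lambda -> y ∈ d].

Definition skolem (i : nat) (p : formula) (e : nat -> V) : V :=
  get [set x | sat setT (upd e i x) p].

(** Along an increasing chain these clauses make the union meet [lambda] in an
    ordinal, contain its subsets of size at most theta, and pass the test of
    Tarski and Vaught. *)
Definition step X : set V := [set z | [\/ X z, z ∈ sup_of X,
  (forall t, t ∈ z -> X t) /\ embeds (El z) (El theta) |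
  exists i p e, (forall j : nat, X (e j)) /\ z = skolem i p e]].

Lemma sup_ofP X : below lambda (members X) -> sup_of X ∈ lambda /\
  forall y, X y -> y ∈ lambda -> y ∈ sup_of X.
Proof.
move=> lX; rewrite /sup_of; case: xgetP => // h; exfalso.
have [s sP] := v_sep lambda X; have [_ _ /(_ s)[]] := lreg.
- by move=> z /sP[].
- apply/(smaller_thanE lreg); apply: below_embeds lX.
  apply: (embeds_rel (F := fun (u : members X) (z : El s) => \val z = sval u)).
    by move=> z; have /sP[_ Xz] := elP z; exists (exist _ _ Xz).
  by move=> u z z' <- /el_inj.
by move=> b bl bP; apply: (h b); split=> // y Xy yl; apply: bP; exact/sP.
Qed.

Lemma below_step X : below lambda (members X) -> below lambda (members (step X)).
Proof.
move=> lX; have [sl _] := sup_ofP lX.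
have ltheta := below_theta lreg lexp.
have lnat : below lambda nat := below_embeds ntheta ltheta.
have lform : below lambda formula := below_embeds formula_countable lnat.
have lopt : below lambda (option (members X)).
  have := below_sum lreg ntheta lexp (below_embeds (embeds_refl _) lX) lnat.
  apply: below_embeds; exists (fun o => if o is Some u then inl u else inr 0%N).
  by move=> [u|] [v|] // [->].
have lfun := below_fun lreg lexp lopt.
have lenv : below lambda (nat -> members X).
  apply: below_embeds lfun; apply: (@embeds_trans _ (nat -> option (members X))).
    by apply: embeds_fun; exists some => u v [].
  exact: embeds_funl ntheta None.
have lsup : below lambda (El (sup_of X)) by exists (sup_of X) => //; exact: embeds_refl.
have := below_sum lreg ntheta lexp lX (below_sum lreg ntheta lexp lsup
  (below_sum lreg ntheta lexp lfun (below_prod lreg ntheta lexp lnat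
     (below_prod lreg ntheta lexp lform lenv)))).
apply: below_embeds.
apply: (embeds_rel (F := fun u (z : members (step X)) => match u with
  | inl v => sval z = sval v
  | inr (inl v) => sval z = \val v
  | inr (inr (inl f)) => forall t, t ∈ sval z <-> exists i v, f i = Some v /\ t = sval v
  | inr (inr (inr (i, (p, e)))) => sval z = skolem i p (fun j => sval (e j))
  end)).
  move=> [z [zX|zs|[zX [g gi]]|[i [p [e [eX ze]]]]]] /=.
  - by exists (inl (exist _ z zX)).
  - by exists (inr (inl (elm zs))).
  - pose f i : option (members X) := if pselect (exists t, g t = i) is left h
      then Some (exist _ _ (zX _ (elP (projT1 (cid h))))) else None.
    exists (inr (inr (inl f))) => t; split=> [tz|[i [v []]]].
      exists (g (elm tz)); rewrite /f; case: pselect => [h|[]]; last by eexists.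
      by eexists; split; first reflexivity; case: cid => /= u /gi ->.
    by rewrite /f; case: pselect => // h [<-] -> /=; exact: elP.
  - by exists (inr (inr (inr (i, (p, fun j => exist _ (e j) (eX j)))))).
move=> [u|[u|[f|[i [p e]]]]] z z'.
- by move=> <- /members_inj.
- by move=> <- /members_inj.
- move=> zf zf'; apply: members_inj; apply: zfc_ext => t.
  by rewrite zf zf'.
- by move=> <- /members_inj.
Qed.

Lemma below_setU X Y : below lambda (members X) -> below lambda (members Y) ->
  below lambda (members (X `|` Y)).
Proof.
move=> lX lY; apply: below_embeds (below_sum lreg ntheta lexp lX lY).
apply: (embeds_rel (F := fun u (z : members (X `|` Y)) => match u with
  | inl v => sval z = sval v | inr v => sval z = sval v end)).
  by move=> [z [zX|zY]]; [exists (inl (exist _ z zX))|exists (inr (exist _ z zY))].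
by move=> [u|u] z z' <- /members_inj.
Qed.

Lemma below_bigcup I (A : set I) (X : I -> set V) : below lambda {i | A i} ->
  (forall i, A i -> below lambda (members (X i))) ->
  below lambda (members (\bigcup_(i in A) X i)).
Proof.
move=> lI lX; have := below_sigma lreg ntheta lexp lI (fun i => lX _ (proj2_sig i)).
apply: below_embeds; apply: (embeds_rel (F :=
  fun (u : {i : {i | A i} & members (X (sval i))})
      (z : members (\bigcup_(i in A) X i)) => sval z = sval (tagged u))).
  by move=> [z [i Ai Xz]]; exists (existT _ (exist _ i Ai) (exist _ z Xz)).
by move=> u z z' <- /members_inj.
Qed.

Lemma below_members x : below lambda (El x) -> below lambda (members [set z | z ∈ x]).
Proof.
apply: below_embeds; exists (fun u : members [set z | z ∈ x] => elm (proj2_sig u)).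
by move=> u v /(congr1 val) /= /members_inj.
Qed.

Let kappa := succ_card theta.

(** The chain has length theta^+, which is regular, so any family of at most
    theta elements of the union belongs to a single stage and is taken care of
    at the next one. This applies to the subsets of size at most theta and to
    the assignments of the variables of a formula. *)
Lemma hull (sig P : V) : embeds (El sig) (El theta) -> smaller_than lambda P ->
  exists N, [/\ vsub P N, vsub sig N, sig ∈ N, elem1 N &
    [/\ ordinal (vinter N lambda), smaller_than lambda N & lt_closed kappa N]].
Proof.
move=> sigt /(smaller_thanE lreg) lP.
have [ck tk kP] := succ_cardP ctheta; rewrite -/kappa in ck tk kP.
have ok : ordinal kappa by case: ck.
have rk : regular kappa := succ_card_regular ctheta ntheta.
pose P0 := [set z | z ∈ P] `|` ([set z | z ∈ sig] `|` [set z | z ∈ vupair sig sig]).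
have lP0 : below lambda (members P0).
  apply: below_setU; first exact: below_members.
  apply: below_setU; apply: below_members.
    exact: below_embeds sigt (below_theta lreg lexp).
  apply: below_embeds (below_theta lreg lexp); have [n _] := ntheta.
  exists (fun=> n 0%N) => a b _; apply: el_inj.
  have -> : \val a = sig by have /vupairE[] := elP a.
  by have /vupairE[] := elP b.
pose F (a : El kappa) (rec : forall b : El kappa, \val b ∈ \val a -> set V) : set V :=
  step (P0 `|` [set z | exists b (h : \val b ∈ \val a), rec b h z]).
pose St := Fix (ord_mem_wf ok) (fun=> set V) F.
pose X (a : El kappa) := P0 `|` \bigcup_(b in [set b : El kappa | \val b ∈ \val a]) St b.
have StE a : St a = step (X a).
  rewrite /St Fix_eq; last first.
    move=> b g h gh; congr F; apply: functional_extensionality_dep => u.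
    by apply: functional_extensionality_dep => p; exact: gh.
  congr (step (P0 `|` _)); apply/seteqP.
  by split=> z => [[b [h bz]]|[b h bz]]; [exists b|exists b, h].
have lX a : below lambda (members (X a)).
  elim/(well_founded_ind (ord_mem_wf ok)): a => a IH.
  apply: below_setU => //; apply: below_bigcup.
    apply: below_embeds (below_succ_theta lreg ctheta lexp).
    by exists sval => -[u p] [v q] /= e; subst v; congr exist; exact: Prop_irrelevance.
  by move=> b ba; rewrite StE; apply: below_step; exact: IH.
pose NC := \bigcup_(a in [set: El kappa]) St a.
have lNC : below lambda (members NC).
  apply: below_bigcup; last by move=> a _; rewrite StE; exact: below_step.
  apply: below_embeds (below_succ_theta lreg ctheta lexp).
  by exists sval => -[u p] [v q] /= e; subst v; congr exist; exact: Prop_irrelevance.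
have [N NP] := small_range (fun u : members NC => sval u) (below_small lreg lNC).
have {}NP z : z ∈ N <-> NC z.
  by rewrite NP; split=> [[[u p] ->]|h]; [|exists (exist _ z h)].
have bound I (f : I -> V) : embeds I (El theta) -> (forall i, f i ∈ N) ->
    exists b : El kappa, forall i, X b (f i).
  move=> It fN; have /choice[g gP] : forall i, exists a : El kappa, St a (f i).
    by move=> i; have /NP[a _ h] := fN i; exists a.
  have sI : small V I by exists theta.
  have [s sP] := small_range (fun i => \val (g i)) sI.
  have [_ _ /(_ s)[]] := rk.
  - by move=> z /sP[i ->]; exact: elP.
  - apply/kP; first exact: small_El.
    apply: embeds_trans It; apply: (embeds_rel (F := fun i (z : El s) => \val z = \val (g i))).
      by move=> z; have /sP := elP z.
    by move=> i z z' <- /el_inj.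
  move=> b bk bP; exists (elm bk) => i; right; exists (g i) => //=.
  by apply: bP; apply/sP; exists i.
have P0N z : P0 z -> z ∈ N.
  by move=> Pz; apply/NP; exists (elm tk) => //; rewrite StE; constructor 1; left.
have stN a z : step (X a) z -> z ∈ N by move=> h; apply/NP; exists a => //; rewrite StE.
exists N; split.
- by move=> z zP; apply: P0N; left.
- by move=> z zP; apply: P0N; right; left.
- by apply: P0N; right; right; apply/vupairE; left.
- split; first by exists sig; apply: P0N; right; right; apply/vupairE; left.
  move=> p e _; elim: p e => /= [i j|i j|p IH|p IHp q IHq|i p IH] e eN.
  + by [].
  + by [].
  + by rewrite IH.
  + by rewrite IHp // IHq.
  split=> [[x xN /IH]|[x _ h]].
    by move=> h; exists x => //; apply: h => j; case: (j == i).
  have [b bX] := bound _ e ntheta eN.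
  have wN : skolem i p e ∈ N by apply: (stN b); constructor 4; exists i, p, e.
  exists (skolem i p e) => //; apply/IH; first by move=> j; case: (j == i).
  rewrite /skolem; case: (xgetP point [set x | sat setT (upd e i x) p]) => //.
  by move=> /(_ x).
split.
- have tN y z : y ∈ N -> y ∈ lambda -> z ∈ y -> z ∈ N.
    move=> yN yl zy; have [||b bX] := bound unit (fun=> y) => //.
      by have [n _] := ntheta; exists (fun=> n 0%N) => -[] [].
    have [sl slP] := sup_ofP (lX b); apply: (stN b); constructor 2.
    exact: ord_trans (ord_el lord sl) zy (slP _ (bX tt) yl).
  split=> [y /vinterE[yN yl] z zy|y /vinterE[_ yl]].
    by apply/vinterE; split; [exact: tN yl zy|exact: ord_trans lord zy yl].
  by case: (ord_el lord yl).
- apply/(smaller_thanE lreg); apply: below_embeds lNC.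
  exists (fun z : El N => exist _ (\val z) ((NP _).1 (elP z)) : members NC).
  by move=> u v /(congr1 sval) /el_inj.
- move=> s sN /(kP _ (small_El s)) st.
  have [b bX] := bound _ (fun u : El s => \val u) st (fun u => sN _ (elP u)).
  by apply: (stN b); constructor 3; split=> // t ts; exact: (bX (elm ts)).
Qed.

End Hull.

(** * Copies of small sets in an elementary submodel *)

Definition FOr p q := FNot (FAnd (FNot p) (FNot q)).
Definition FImp p q := FNot (FAnd p (FNot q)).
Definition FBex i j p := FEx i (FAnd (FIn i j) p).
Definition FAll i j p := FNot (FBex i j (FNot p)).
Definition FUpair s x y z := FAnd (FIn x s) (FAnd (FIn y s)
  (FAll z s (FOr (FEq z x) (FEq z y)))).
(** This formula binds the variables 30 and 31, [FApp] moreover 32, and [FApp2]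
    33, 34 and 35; they must not be among the arguments. *)
Definition FPair p x y := FAnd (FBex 30 p (FUpair 30 x x 31))
  (FAnd (FBex 30 p (FUpair 30 x y 31))
        (FAll 30 p (FOr (FUpair 30 x x 31) (FUpair 30 x y 31)))).
Definition FApp r i x := FBex 32 r (FPair 32 i x).
Definition FApp2 r k i j := FBex 33 r (FBex 34 33 (FBex 35 34
  (FAnd (FPair 35 i j) (FPair 33 k 35)))).

Section Reflection.
Variable V : zfc.
Implicit Types (x y z s c d : V) (P X : set V) (e : nat -> V).

Lemma sat_or e p q : sat setT e (FOr p q) <-> sat setT e p \/ sat setT e q.
Proof.
rewrite /=; split=> [h|[h|h] []//].
have [|np] := pselect (sat setT e p); first by left.
by have [|nq] := pselect (sat setT e q); [right|case: h].
Qed.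

Lemma sat_imp e p q (P Q : Prop) : (sat setT e p <-> P) -> (sat setT e q <-> Q) ->
  (sat setT e (FImp p q) <-> (P -> Q)).
Proof.
move=> pP qQ /=; split=> [h /pP hp|h [/pP hp nq]]; last by apply/nq/qQ/h.
by apply/qQ; apply: contrapT => nq; apply: h.
Qed.

Lemma sat_and e p q (P Q : Prop) : (sat setT e p <-> P) -> (sat setT e q <-> Q) ->
  (sat setT e (FAnd p q) <-> (P /\ Q)).
Proof. by move=> pP qQ /=; rewrite pP qQ. Qed.

Lemma sat_bex e i j p Q : j != i -> (forall x, sat setT (upd e i x) p <-> Q x) ->
  (sat setT e (FBex i j p) <-> exists x, x ∈ e j /\ Q x).
Proof.
move=> ij pQ /=; rewrite eqxx (negbTE ij); split=> [[x _ [xj /pQ Qx]]|[x [xj /pQ h]]].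
  by exists x.
by exists x.
Qed.

Lemma sat_all e i j p Q : j != i -> (forall x, sat setT (upd e i x) p <-> Q x) ->
  (sat setT e (FAll i j p) <-> forall x, x ∈ e j -> Q x).
Proof.
move=> ij pQ; rewrite /FAll.
have -> : sat setT e (FNot (FBex i j (FNot p))) =
   ~ sat setT e (FBex i j (FNot p)) by [].
rewrite (sat_bex (Q := fun x => ~ Q x)) //; last by move=> x /=; rewrite pQ.
split=> [h x xj|h [x [xj]]]; last by apply; exact: h.
by apply: contrapT => nQ; apply: h; exists x.
Qed.

Lemma sat_upair e (s x y z : nat) : s != z -> x != z -> y != z ->
  (sat setT e (FUpair s x y z) <-> e s = vupair (e x) (e y)).
Proof.
move=> sz xz yz; rewrite (@sat_and _ _ _ (e x ∈ e s) (e y ∈ e s /\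
    forall t, t ∈ e s -> t = e x \/ t = e y)) //.
  split=> [[xs [ys st]]|->].
    apply: zfc_ext => t; rewrite vupairE; split=> [/st//|].
    by case=> ->.
  split; first by apply/vupairE; left.
  by split; [apply/vupairE; right|move=> t /vupairE].
apply: sat_and => //; apply: sat_all => // t; rewrite sat_or /= /upd eqxx.
by rewrite (negbTE xz) (negbTE yz).
Qed.

Lemma sat_pair e (p x y : nat) : (p < 30)%N || (31 < p)%N -> (x < 30)%N || (31 < x)%N ->
  (y < 30)%N || (31 < y)%N ->
  (sat setT e (FPair p x y) <-> e p = vpair (e x) (e y)).
Proof.
have ne (z : nat) : (z < 30)%N || (31 < z)%N -> (z != 30)%N /\ (z != 31)%N.
  by move=> h; split; apply/eqP=> e0; rewrite e0 in h.
move=> /ne[p0 p1] /ne[x0 x1] /ne[y0 y1].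
have ue s (a : nat) : a != 30%N -> upd e 30 s a = e a.
  by rewrite /upd => /negbTE ->.
have up (a b : nat) s : a != 30%N -> a != 31%N -> b != 30%N -> b != 31%N ->
    (sat setT (upd e 30 s) (FUpair 30 a b 31) <-> s = vupair (e a) (e b)).
  by move=> a0 a1 b0 b1; rewrite sat_upair // (ue _ a) // (ue _ b).
rewrite (@sat_and _ _ _ (exists s, s ∈ e p /\ s = vupair (e x) (e x))
  ((exists s, s ∈ e p /\ s = vupair (e x) (e y)) /\ forall s, s ∈ e p ->
    s = vupair (e x) (e x) \/ s = vupair (e x) (e y))); last 2 first.
- by apply: sat_bex => // s; exact: up.
- apply: sat_and; first by apply: sat_bex => // s; exact: up.
  by apply: sat_all => // s; rewrite sat_or !up.
split=> [[[s [sp es]] [[t [tp et]] st]]|->].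
  subst s t; apply: zfc_ext => u; rewrite vupairE.
  by split=> [/st//|[]->].
split; first by exists (vupair (e x) (e x)); split=> //; apply/vupairE; left.
split; first by exists (vupair (e x) (e y)); split=> //; apply/vupairE; right.
by move=> s /vupairE.
Qed.

Lemma sat_app e (r i x : nat) : (r < 30)%N -> (i < 30)%N -> (x < 30)%N ->
  (sat setT e (FApp r i x) <-> vpair (e i) (e x) ∈ e r).
Proof.
have ne (z : nat) : (z < 30)%N -> (z == 32)%N = false.
  by move=> h; apply: contraTF h => /eqP->.
move=> r0 i0 x0; rewrite /FApp (sat_bex (Q := fun p => p = vpair (e i) (e x))).
- by split=> [[p [pr <-]]//|h]; exists (vpair (e i) (e x)).
- by rewrite ne.
by move=> p; rewrite sat_pair ?i0 ?x0 // /upd (ne i) // (ne x).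
Qed.

Lemma sat_app2 e (r k i j : nat) :
  (r < 30)%N -> (k < 30)%N -> (i < 30)%N -> (j < 30)%N ->
  (sat setT e (FApp2 r k i j) <-> vpair (e k) (vpair (e i) (e j)) ∈ e r).
Proof.
have ne (z t : nat) : (z < 30)%N -> (z == 32 + t)%N = false.
  by move=> h; apply: contraTF h => /eqP->; rewrite -leqNgt ltnW // ltn_addr.
move=> r0 k0 i0 j0; rewrite /FApp2.
rewrite (sat_bex (Q := fun q => exists t, t ∈ q /\ exists d, d ∈ t /\ (d = vpair (e i) (e j) /\ q = vpair (e k) d))).
- split=> [[q [qr [t [tq [d [dt [-> qE]]]]]]]|h]; first by rewrite -qE.
  exists (vpair (e k) (vpair (e i) (e j))); split=> //.
  exists (vupair (e k) (vpair (e i) (e j))); split.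
    by apply/vupairE; right.
  by exists (vpair (e i) (e j)); split=> //; apply/vupairE; right.
- by rewrite (ne _ 1%N).
move=> q; apply: sat_bex => // t; apply: sat_bex => // d.
have ue (z : nat) : (z < 30)%N ->
    upd (upd (upd e 33 q) 34 t) 35 d z = e z.
  by move=> z0; rewrite /upd (ne z 1%N) // (ne z 2%N) // (ne z 3%N).
by apply: sat_and; rewrite sat_pair ?i0 ?j0 ?k0 // ?(ue i) ?(ue j) ?(ue k).
Qed.

(* Names of the free variables of [copy_formula]. *)
Local Notation RHO := 0%N.
Local Notation W := 1%N.
Local Notation I := 2%N.
Local Notation FIXED := 3%N.
Local Notation MEM := 4%N.
Local Notation PAIR := 5%N.
Local Notation C := 12%N.

(** [copy_formula] says that RHO maps I to W, extends the part of the function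
    FIXED with values in C, and turns the relations MEM and PAIR between indices
    into membership and pairing. *)
Definition copy_total := FAll 6 I (FBex 7 W (FApp RHO 6 7)).
Definition copy_functional := FAll 6 I (FAll 7 W (FAll 8 W
  (FImp (FApp RHO 6 7) (FImp (FApp RHO 6 8) (FEq 7 8))))).
Definition copy_fixed := FAll 6 I (FAll 7 C
  (FImp (FApp FIXED 6 7) (FAnd (FIn 7 W) (FApp RHO 6 7)))).
Definition copy_mem := FAll 6 I (FAll 7 I (FAll 8 W (FAll 9 W
  (FImp (FApp MEM 6 7)
     (FImp (FApp RHO 6 8) (FImp (FApp RHO 7 9) (FIn 8 9))))))).
Definition copy_pair := FAll 6 I (FAll 7 I (FAll 8 I
  (FAll 9 W (FAll 10 W (FAll 11 W (FImp (FApp2 PAIR 6 7 8)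
     (FImp (FApp RHO 6 9) (FImp (FApp RHO 7 10)
        (FImp (FApp RHO 8 11) (FPair 9 10 11)))))))))).
Definition copy_formula := FAnd copy_total (FAnd copy_functional
  (FAnd copy_fixed (FAnd copy_mem copy_pair))).

Record copy (rho w i c fixed mem pair : V) : Prop := Copy {
  copyT : forall a, a ∈ i -> exists x, x ∈ w /\ vpair a x ∈ rho;
  copyF : forall a, a ∈ i -> forall x, x ∈ w -> forall y, y ∈ w ->
    vpair a x ∈ rho -> vpair a y ∈ rho -> x = y;
  copyX : forall a, a ∈ i -> forall x, x ∈ c -> vpair a x ∈ fixed ->
    x ∈ w /\ vpair a x ∈ rho;
  copyM : forall a, a ∈ i -> forall b, b ∈ i ->
    forall x, x ∈ w -> forall y, y ∈ w -> vpair a b ∈ mem ->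
    vpair a x ∈ rho -> vpair b y ∈ rho -> x ∈ y;
  copyP : forall a, a ∈ i -> forall b, b ∈ i -> forall d, d ∈ i ->
    forall x, x ∈ w -> forall y, y ∈ w -> forall z, z ∈ w ->
    vpair a (vpair b d) ∈ pair ->
    vpair a x ∈ rho -> vpair b y ∈ rho -> vpair d z ∈ rho -> x = vpair y z
}.

Lemma sat_copy e : sat setT e copy_formula <->
  copy (e RHO) (e W) (e I) (e C) (e FIXED) (e MEM) (e PAIR).
Proof.
have hT : sat setT e copy_total <-> forall a, a ∈ e I -> exists x, x ∈ e W /\
    vpair a x ∈ e RHO.
  apply: sat_all => // a; apply: sat_bex => // x; exact: sat_app.
have hF : sat setT e copy_functional <-> forall a, a ∈ e I ->
    forall x, x ∈ e W -> forall y, y ∈ e W ->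
    vpair a x ∈ e RHO -> vpair a y ∈ e RHO -> x = y.
  do 3 (apply: sat_all => // ?); do 2 (apply: sat_imp; first exact: sat_app).
  by [].
have hX : sat setT e copy_fixed <-> forall a, a ∈ e I -> forall x, x ∈ e C ->
    vpair a x ∈ e FIXED -> x ∈ e W /\ vpair a x ∈ e RHO.
  do 2 (apply: sat_all => // ?); apply: sat_imp; first exact: sat_app.
  by apply: sat_and => //; exact: sat_app.
have hM : sat setT e copy_mem <-> forall a, a ∈ e I -> forall b, b ∈ e I ->
    forall x, x ∈ e W -> forall y, y ∈ e W -> vpair a b ∈ e MEM ->
    vpair a x ∈ e RHO -> vpair b y ∈ e RHO -> x ∈ y.
  do 4 (apply: sat_all => // ?); do 3 (apply: sat_imp; first exact: sat_app).
  by [].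
have hP : sat setT e copy_pair <->
    forall a, a ∈ e I -> forall b, b ∈ e I -> forall d, d ∈ e I ->
    forall x, x ∈ e W -> forall y, y ∈ e W -> forall z, z ∈ e W ->
    vpair a (vpair b d) ∈ e PAIR ->
    vpair a x ∈ e RHO -> vpair b y ∈ e RHO -> vpair d z ∈ e RHO -> x = vpair y z.
  do 6 (apply: sat_all => // ?); apply: sat_imp; first exact: sat_app2.
  do 3 (apply: sat_imp; first exact: sat_app); exact: sat_pair.
have -> : sat setT e copy_formula = (sat setT e copy_total /\
  (sat setT e copy_functional /\ (sat setT e copy_fixed /\
   (sat setT e copy_mem /\ sat setT e copy_pair)))) by [].
rewrite hT hF hX hM hP; split=> [[? [? [? []]]] *|[]]; last by [].
by constructor.
Qed.

Lemma delta0_copy : delta0 copy_formula.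
Proof. by repeat constructor. Qed.

Lemma elem1_witness N p e i x : elem1 N -> sigma1 p -> (forall j, e j ∈ N) ->
  sat setT (upd e i x) p -> exists2 y, y ∈ N & sat setT (upd e i y) p.
Proof.
move=> [_ N1] p1 eN h; have [_] := N1 _ _ (sigma1_ex i p1) eN.
case; first by exists x.
move=> y yN hy; exists y => //; apply/(N1 _ _ p1) => // j.
by rewrite /upd; case: (j == i).
Qed.

Section Closed.
Variables (theta N : V).
Hypotheses (ctheta : cardinal theta) (ntheta : embeds nat (El theta)).
Hypotheses (N1 : elem1 N) (Ncl : lt_closed (succ_card theta) N).

Lemma closed_mem s : vsub s N -> embeds (El s) (El theta) -> s ∈ N.
Proof.
move=> sN st; apply: Ncl => //; have [_ _ cP] := succ_cardP ctheta.
by apply/cP => //; exact: small_El.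
Qed.

Lemma closed_range T (f : T -> V) : embeds T (El theta) -> (forall t, f t ∈ N) ->
  exists2 s, s ∈ N & forall z, z ∈ s <-> exists t, z = f t.
Proof.
move=> Tt fN; have sT : small V T by exists theta.
have [s sP] := small_range f sT; exists s => //; apply: closed_mem.
  by move=> z /sP[t ->].
apply: embeds_trans Tt; apply: (embeds_rel (F := fun t (z : El s) => \val z = f t)).
  by move=> z; have /sP := elP z.
by move=> t z z' <- /el_inj.
Qed.

Lemma closed_upair x y : x ∈ N -> y ∈ N -> vupair x y ∈ N.
Proof.
move=> xN yN; have [||s sN sP] := @closed_range bool (fun b => if b then x else y).
- by apply: embeds_trans ntheta; exists nat_of_bool => -[] [].
- by case.
rewrite (_ : vupair x y = s) //; apply: zfc_ext => z; rewrite vupairE sP.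
by split=> [[]->|[[] ->]]; [exists true|exists false|left|right].
Qed.

Lemma closed_pair x y : x ∈ N -> y ∈ N -> vpair x y ∈ N.
Proof. by move=> xN yN; apply: closed_upair; exact: closed_upair. Qed.

(** Otherwise [N] would be one of its own small subsets, and so N ∈ N. *)
Lemma closed_large : embeds (El theta) (El N).
Proof.
have [//|h] := embeds_total (small_El theta) (small_El N); exfalso.
by apply: (@vnonself V N); apply: closed_mem.
Qed.

(** The elements of [T] are indexed by elements of [N], by means of [j], so that
    the relations between them become elements of [N]. The inclusion of [T] then
    satisfies [copy_formula], whose parameters are in [N]. *)
Lemma reflect_set T : embeds (El T) (El theta) -> exists rho : V -> V, [/\
  forall x, x ∈ T -> rho x ∈ N, forall x, x ∈ T -> x ∈ N -> rho x = x,
  forall x y, x ∈ T -> y ∈ T -> x ∈ y -> rho x ∈ rho y &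
  forall x y z, x ∈ T -> y ∈ T -> z ∈ T -> x = vpair y z ->
    rho x = vpair (rho y) (rho z)].
Proof.
move=> Tt; have [j ji] := embeds_trans Tt closed_large.
have jN t : \val (j t) ∈ N := elP _.
have TT := embeds_absorb_prod (hessenberg (small_El theta) ntheta) Tt Tt.
have TTT := embeds_absorb_prod (hessenberg (small_El theta) ntheta) Tt TT.
have sub U (P : U -> Prop) : embeds {u | P u} U.
  by exists sval => -[u p] [v q] /= e; subst v; congr exist; exact: Prop_irrelevance.
have [i iN iP] := closed_range Tt jN.
have [c cN cP] := closed_range (embeds_trans (sub _ (fun t : El T => \val t ∈ N)) Tt)
  (fun u => proj2_sig u).
have [fixed fN fP] := closed_range (embeds_trans (sub _ (fun t : El T => \val t ∈ N)) Tt)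
  (fun u => closed_pair (jN (sval u)) (proj2_sig u)).
have [mem mN mP] := closed_range
  (embeds_trans (sub _ (fun t : El T * El T => \val t.1 ∈ \val t.2)) TT)
  (fun u => closed_pair (jN (sval u).1) (jN (sval u).2)).
have [pair pN pP] := closed_range
  (embeds_trans (sub _ (fun t : El T * (El T * El T) =>
     \val t.1 = vpair (\val t.2.1) (\val t.2.2))) TTT)
  (fun u => closed_pair (jN (sval u).1)
     (closed_pair (jN (sval u).2.1) (jN (sval u).2.2))).
have [rho0 rho0P] := small_range (fun t : El T => vpair (\val (j t)) (\val t))
  (small_El T).
have jeq t u : \val (j t) = \val (j u) -> t = u by move/el_inj/ji.
have rE t x : vpair (\val (j t)) x ∈ rho0 -> x = \val t.
  by move=> /rho0P[u /vpair_inj[/jeq<- ->]].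
have c0 : copy rho0 T i c fixed mem pair.
  split.
  - move=> _ /iP[t ->]; exists (\val t); split; first exact: elP.
    by apply/rho0P; exists t.
  - by move=> _ /iP[t ->] x xT y yT /rE -> /rE ->.
  - move=> _ /iP[t ->] x _ /fP[[u uN] /= /vpair_inj[/jeq <- ->]].
    by split; [exact: elP|apply/rho0P; exists t].
  - move=> _ /iP[t ->] _ /iP[u ->] x xT y yT.
    by move=> /mP[[[t' u'] /= tu] /vpair_inj[/jeq-> /jeq->]] /rE-> /rE->.
  - move=> _ /iP[t ->] _ /iP[u ->] _ /iP[v ->] x xT y yT z zT.
    move=> /pP[[[t' [u' v']] /= tu] /vpair_inj[/jeq-> /vpair_inj[/jeq-> /jeq->]]].
    by move=> /rE-> /rE-> /rE->.
(* The variables 6 to 11 of [copy_formula] are bound. *)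
pose e k := nth i [:: i; i; i; fixed; mem; pair; i; i; i; i; i; i; c] k.
have eN k : e k ∈ N.
  by rewrite /e; do 13 (case: k => [|k] //=); rewrite nth_nil.
have [w wN hw] : exists2 w, w ∈ N & sat setT (upd e W w) (FEx RHO copy_formula).
  apply: (@elem1_witness _ _ _ _ T) => //.
    by apply: sigma1_ex; apply: sigma1_delta0; exact: delta0_copy.
  by exists rho0 => //; apply/sat_copy.
have {hw}[r rN hr] : exists2 r, r ∈ N & sat setT (upd (upd e W w) RHO r) copy_formula.
  case: hw => r _ hr; apply: (@elem1_witness _ _ _ _ r) => //.
    by apply: sigma1_delta0; exact: delta0_copy.
  by move=> k; rewrite /upd; case: (k == _).
have {hr}cr : copy r w i c fixed mem pair by move/sat_copy: hr.
have ex (t : El T) : exists x, [/\ x ∈ N, x ∈ w & vpair (\val (j t)) x ∈ r].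
  have [|x [xw xr]] := copyT cr (a := \val (j t)); first by apply/iP; exists t.
  pose e' := upd (upd (upd e W w) RHO r) 6 (\val (j t)).
  have e'N k : e' k ∈ N.
    by rewrite /e' /upd; do 3 (case: (k == _) => //).
  have h y : sat setT (upd e' 7 y) (FAnd (FIn 7 W) (FApp RHO 6 7)) <->
      y ∈ w /\ vpair (\val (j t)) y ∈ r.
    by apply: sat_and => //; exact: sat_app.
  have [||||y yN /h[]] := @elem1_witness N (FAnd (FIn 7 W) (FApp RHO 6 7)) e' 7 x.
  - exact: N1.
  - by apply: sigma1_delta0; repeat constructor.
  - by [].
  - by apply/h.
  by exists y.
have [f fPr] := choice ex.
pose rho x := if pselect (x ∈ T) is left h then f (elm h) else x.
have rhoE x (h : x ∈ T) : rho x = f (elm h).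
  rewrite /rho; case: pselect => // h'; congr (f _); exact: el_inj.
have fw t : f t ∈ w by have [] := fPr t.
have fr t : vpair (\val (j t)) (f t) ∈ r by have [] := fPr t.
have it t : \val (j t) ∈ i by apply/iP; exists t.
exists rho; split=> [x xT|x xT xN|x y xT yT xy|x y z xT yT zT xyz]; rewrite !rhoE.
- by have [] := fPr (elm xT).
- have [||h1 h2] := copyX cr (it (elm xT)) (x := x).
  + by apply/cP; exists (exist _ (elm xT) xN).
  + by apply/fP; exists (exist _ (elm xT) xN).
  by apply: (copyF cr (it (elm xT))).
- apply: (copyM cr (it (elm xT)) (it (elm yT))) => //.
  by apply/mP; exists (exist _ (elm xT, elm yT) xy).
- apply: (copyP cr (it (elm xT)) (it (elm yT)) (it (elm zT))) => //.
  by apply/pP; exists (exist _ (elm xT, (elm yT, elm zT)) xyz).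
Qed.

End Closed.
End Reflection.

(** * Retractions of small substructures onto the trace *)

Section Signatures.
Local Open Scope ring_scope.
Import GRing.Theory.

Section Tiny.
Variables (V : zfc) (theta : V).
Hypotheses (ctheta : cardinal theta) (ntheta : embeds nat (El theta)).

Let square : embeds (El theta * El theta) (El theta).
Proof. exact: hessenberg (small_El theta) ntheta. Qed.

Definition tiny (A : set V) := embeds (members A) (El theta).

Lemma tiny_range I (f : I -> V) : embeds I (El theta) -> tiny (range f).
Proof.
apply: embeds_trans; apply: (embeds_rel (F := fun i (z : members (range f)) => sval z = f i)).
  by move=> [z [i Ti iz]]; exists i.
by move=> i z z' <- /members_inj.
Qed.

Lemma tiny_bigcup I (A : I -> set V) : embeds I (El theta) ->
  (forall i, tiny (A i)) -> tiny (\bigcup_(i in [set: I]) A i).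
Proof.
move=> It At; apply: embeds_trans (embeds_sigma square It At).
apply: (embeds_rel (F := fun (u : {i : I & members (A i)})
  (z : members (\bigcup_(i in [set: I]) A i)) => sval z = sval (tagged u))).
  by move=> [z [i Ti Az]]; exists (existT _ i (exist _ z Az)).
by move=> u z z' <- /members_inj.
Qed.

Lemma embeds_bool_theta : embeds bool (El theta).
Proof. by apply: embeds_trans ntheta; exists nat_of_bool => -[] []. Qed.

Lemma tiny_setU A B : tiny A -> tiny B -> tiny (A `|` B).
Proof.
move=> tA tB; rewrite (_ : A `|` B = \bigcup_(b in [set: bool]) if b then A else B).
  by apply: tiny_bigcup embeds_bool_theta _ => -[].
apply/seteqP; split=> z; first by case; [exists true|exists false].
by move=> [[] _]; [left|right].
Qed.

Lemma tiny_set1 a : tiny [set a].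
Proof.
have -> : [set a] = range (fun _ : bool => a).
  by apply/seteqP; split=> [z ->|z [_ _ <-]//]; exists true.
exact: tiny_range embeds_bool_theta.
Qed.

Lemma tiny_set A : tiny A -> exists2 s, (forall z, z ∈ s <-> A z) &
  embeds (El s) (El theta).
Proof.
move=> tA; have [s sP] := small_range (fun u : members A => sval u)
  (ex_intro _ theta tA : small V (members A)).
have {}sP z : z ∈ s <-> A z.
  by rewrite sP; split=> [[[u p] ->]//|Az]; exists (exist _ z Az).
exists s => //; apply: embeds_trans tA.
exists (fun z : El s => exist _ (\val z) ((sP _).1 (elP z)) : members A).
by move=> u v /(congr1 sval) /el_inj.
Qed.

End Tiny.

Section Symbols.
Variables (V : zfc) (R : diagram V).
Local Notation O := (El (obj R)).

Lemma small_symbol : small V (symbol R).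
Proof.
have sO : small V O := small_El _.
have sR : small V {u : O & R u} := small_sigma sO (fun u => small_El (vring_set (R u))).
have sH : small V {p : O * O & El (hom p.1 p.2)}.
  by apply: small_sigma; [exact: small_prod|move=> p; exact: small_El].
apply: small_embeds (small_sum sO (small_sum sO (small_sum sO (small_sum sR sH)))).
exists (fun f => match f with SZero u => inl u | SAdd u => inr (inl u)
  | SOpp u => inr (inr (inl u))
  | SScale u r => inr (inr (inr (inl (existT (fun u => vring_ring (R u)) u r))))
  | SArr u v a => inr (inr (inr (inr
      (existT (fun p : O * O => El (hom p.1 p.2)) (u, v) a)))) end).
move=> [u|u|u|u r|u v a] [u'|u'|u'|u' r'|u' v' a'] //; try by move=> [->].
  move=> e; have {}e : existT (fun u => vring_ring (R u)) u r = existT _ u' r'.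
    by move: e => /(congr1 (fun x => match x with inr (inr (inr (inl p))) => p | _ => existT _ u r end)).
  exact: (congr1 (fun p => SScale (tagged p)) e).
move=> e; have {}e : existT (fun p : O * O => El (hom p.1 p.2)) (u, v) a =
    existT _ (u', v') a'.
  by move: e => /(congr1 (fun x => match x with inr (inr (inr (inr p))) => p
     | _ => existT (fun p : O * O => El (hom p.1 p.2)) (u, v) a end)).
exact: (congr1 (fun p => SArr (tagged p)) e).
Qed.

Lemma symbol_code_inj : injective (@symbol_code V R).
Proof.
pose tag (f : symbol R) : nat := match f with SZero _ => 0 | SAdd _ => 1
  | SOpp _ => 2 | SScale _ _ => 3 | SArr _ _ _ => 4 end.
have tagE f : exists w, symbol_code f = vpair (vnat V (tag f)) w.
  by case: f => *; eexists.
move=> f g e; have : tag f = tag g.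
  have [w fw] := tagE f; have [w' gw] := tagE g.
  by move: e; rewrite fw gw => /vpair_inj[/vnat_inj].
case: f g e => [u|u|u|u r|u v a] [u'|u'|u'|u' r'|u' v' a'] // e _;
  move: e; rewrite /symbol_code => /vpair_inj[_]; try by move=> /el_inj ->.
- move=> /vpair_inj[/el_inj e]; subst u'; rewrite /vring_val => /el_inj r12.
  by rewrite (r12 : r = r').
- move=> /vpair_inj[/vpair_inj[/el_inj e /el_inj e']]; subst u' v'.
  by move=> /el_inj ->.
Qed.

Lemma signatureE z : z ∈ signature R <-> exists f : symbol R, z = symbol_code f.
Proof.
rewrite (vset_smallE (f := @symbol_code V R) small_symbol); first by split=> [[f _ <-]|[f ->]]; exists f.
by move=> t; split=> [[f _ <-]|[f ->]]; exists f.
Qed.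

Let theta := card_of V (El (signature R) + nat).

Lemma small_sig_nat : small V (El (signature R) + nat).
Proof. by apply: small_sum (small_El _) (small_nat _). Qed.

Lemma theta_cardinal : cardinal theta.
Proof. exact: card_of_cardinal small_sig_nat. Qed.

Lemma sig_theta : embeds (El (signature R)) (El theta).
Proof.
by have [+ _] := card_of_bij small_sig_nat; apply: embeds_trans; exists inl => a b [].
Qed.

Lemma nat_theta : embeds nat (El theta).
Proof.
by have [+ _] := card_of_bij small_sig_nat; apply: embeds_trans; exists inr => a b [].
Qed.

Lemma symbol_theta : embeds (symbol R) (El theta).
Proof.
apply: embeds_trans sig_theta.
have h (f : symbol R) : symbol_code f ∈ signature R by apply/signatureE; exists f.
by exists (fun f => elm (h f)) => f g /(congr1 val) /symbol_code_inj.
Qed.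

Lemma ring_theta u : embeds (R u) (El theta).
Proof.
apply: embeds_trans symbol_theta; exists (@SScale V R u) => r s.
move=> /(congr1 (@symbol_code V R)) /= /vpair_inj[_ /vpair_inj[_]].
by rewrite /vring_val => /el_inj.
Qed.

Section Structure.
Variable K : rmodule R.

Lemma kelt_inj u (x y : K u) : kelt x = kelt y -> x = y.
Proof. by rewrite /kelt /vmod_val => /vpair_inj[_ /el_inj]. Qed.

Lemma small_mod u : small V (K u). Proof. exact: (small_El (vmod_set (K u))). Qed.

Lemma interp_addE u z : z ∈ interp K (SAdd u) <-> exists x y : K u,
  z = vpair (vpair (kelt x) (kelt y)) (kelt (x + y)).
Proof.
apply: (vset_smallE (T := (K u * K u)%type)
  (f := fun p => vpair (vpair (kelt p.1) (kelt p.2)) (kelt (p.1 + p.2)))).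
  by apply: small_prod; exact: small_mod.
by move=> t; split=> [[x [y ->]]|[[x y] ->]]; [exists (x, y)|exists x, y].
Qed.

Lemma interp_scaleE u (r : R u) z : z ∈ interp K (SScale r) <->
  exists x : K u, z = vpair (kelt x) (kelt (r *: x)).
Proof. by apply: (vset_smallE (f := fun x : K u => vpair (kelt x) (kelt (r *: x))));
  [exact: small_mod|]. Qed.

Lemma interp_arrE u v (a : El (hom u v)) z : z ∈ interp K (SArr a) <->
  exists x : K u, z = vpair (kelt x) (kelt (rmap K a x)).
Proof. by apply: (vset_smallE (f := fun x : K u => vpair (kelt x) (kelt (rmap K a x))));
  [exact: small_mod|]. Qed.

Definition interp_fun := vset [set z | exists f : symbol R,
  z = vpair (symbol_code f) (interp K f)].

Lemma interp_funE z : z ∈ interp_fun <-> exists f : symbol R,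
  z = vpair (symbol_code f) (interp K f).
Proof. by apply: (vset_smallE (f := fun f : symbol R => vpair (symbol_code f) (interp K f)));
  [exact: small_symbol|]. Qed.

(** [S] is the union of the sorts of a substructure. *)
Record closed_under_ops (S : set V) : Prop := ClosedUnderOps {
  closedD : forall u (x y : K u), S (kelt x) -> S (kelt y) -> S (kelt (x + y));
  closedZ : forall u (r : R u) (x : K u), S (kelt x) -> S (kelt (r *: x));
  closedA : forall u v (a : El (hom u v)) (x : K u),
    S (kelt x) -> S (kelt (rmap K a x))
}.

(** The operations are relations between sets, so that elements of different
    sorts need not be compared by type casts. *)
Definition op_rel (f : symbol R) (a b z : V) : Prop :=
  match f with
  | SAdd u => exists x y : K u, [/\ a = kelt x, b = kelt y & z = kelt (x + y)]
  | SScale u r => exists x : K u, a = kelt x /\ z = kelt (r *: x)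
  | SArr u v h => exists x : K u, a = kelt x /\ z = kelt (rmap K h x)
  | _ => False
  end.

Lemma op_rel_fun f a b z z' : op_rel f a b z -> op_rel f a b z' -> z = z'.
Proof.
case: f => //= [u|u r|u v h].
- by move=> [x [y [-> -> ->]]] [x' [y' [/kelt_inj<- /kelt_inj<- ->]]].
- by move=> [x [-> ->]] [x' [/kelt_inj<- ->]].
- by move=> [x [-> ->]] [x' [/kelt_inj<- ->]].
Qed.

Lemma closure_under_ops S0 : tiny theta S0 ->
  exists S, [/\ S0 `<=` S, tiny theta S & closed_under_ops S].
Proof.
move=> S0t.
pose next (S : set V) := S `|` [set z | exists f a b, [/\ S a, S b & op_rel f a b z]].
pose S n := iter n next S0.
have tS n : tiny theta (S n).
  elim: n => [//|n IH]; rewrite /S iterS; apply: (tiny_setU nat_theta) => //.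
  have sq := hessenberg (small_El theta) nat_theta.
  apply: embeds_trans (embeds_absorb_prod sq symbol_theta (embeds_absorb_prod sq IH IH)).
  apply: (embeds_rel (F := fun (p : symbol R * (members (S n) * members (S n))) z =>
    op_rel p.1 (sval p.2.1) (sval p.2.2) (sval z))).
    move=> [z [f [a [b [Sa Sb h]]]]].
    by exists (f, (exist _ a Sa, exist _ b Sb)).
  by move=> p z z' h h'; apply: members_inj; exact: op_rel_fun h h'.
have mono m n : (m <= n)%N -> S m `<=` S n.
  move=> /subnK <-; elim: (n - m)%N => [//|k IH].
  by apply: (subset_trans IH); rewrite addSn /S iterS; left.
exists (\bigcup_(n in [set: nat]) S n); split.
- by move=> z Sz; exists 0%N.
- exact: (tiny_bigcup nat_theta nat_theta tS).
split.
- move=> u x y [m _ Sx] [n _ Sy]; exists (maxn m n).+1 => //; right.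
  exists (SAdd u), (kelt x), (kelt y); split; last by exists x, y.
    exact: mono (leq_maxl m n) _ Sx.
  exact: mono (leq_maxr m n) _ Sy.
- move=> u r x [n _ Sx]; exists n.+1 => //; right.
  by exists (SScale r), (kelt x), (kelt x); split=> //; exists x.
- move=> u v a x [n _ Sx]; exists n.+1 => //; right.
  by exists (SArr a), (kelt x), (kelt x); split=> //; exists x.
Qed.

End Structure.

Section Retract.
Variables (N : V) (K : rmodule R).
Hypotheses (Nsig : vsub (signature R) N) (N1 : elem1 N)
  (Ncl : lt_closed (succ_card theta) N) (KN : structure_of K ∈ N).

Record retract (S : set V) (rho : forall u, K u -> K u) : Prop := Retract {
  retrN : forall u (x : K u), S (kelt x) -> kelt (rho u x) ∈ N;
  retr_id : forall u (x : K u), S (kelt x) -> kelt x ∈ N -> rho u x = x;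
  retrD : forall u (x y : K u), S (kelt x) -> S (kelt y) -> S (kelt (x + y)) ->
    rho u (x + y) = rho u x + rho u y;
  retrZ : forall u (r : R u) (x : K u), S (kelt x) -> S (kelt (r *: x)) ->
    rho u (r *: x) = r *: rho u x;
  retrA : forall u v (a : El (hom u v)) (x : K u), S (kelt x) ->
    S (kelt (rmap K a x)) -> rho v (rmap K a x) = rmap K a (rho u x)
}.

(** [reflect_set] is applied to [S], completed by the tuples of elements of [S]
    and by the interpretations of the symbols. These are fixed: their symbols
    are in [N] and determine them in the structure, which is in [N]. Then a
    tuple in the graph of an operation is mapped into the same graph. *)
Lemma retract_exists S : tiny theta S -> exists rho, retract S rho.
Proof.
move=> tS; have nt := nat_theta; have sq := hessenberg (small_El theta) nt.
pose code := @symbol_code V R.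
pose T0 := [set structure_of K] `|` ([set underlying_set K] `|` ([set interp_fun K] `|`
  (range code `|` (range (interp K) `|` (range (fun f => vpair (code f) (interp K f)) `|`
  (S `|` (range (fun p : members S * members S => vpair (sval p.1) (sval p.2)) `|`
   range (fun p : members S * members S * members S =>
     vpair (vpair (sval p.1.1) (sval p.1.2)) (sval p.2))))))))).
have tT0 : tiny theta T0.
  do 3 (apply: (tiny_setU nt); first exact: (tiny_set1 nt)).
  do 3 (apply: (tiny_setU nt); first exact: tiny_range symbol_theta).
  have tSS := embeds_absorb_prod sq tS tS.
  apply: (tiny_setU nt) => //; apply: (tiny_setU nt); first exact: tiny_range.
  by apply: tiny_range; exact: embeds_absorb_prod.
have [T TE Tt] := tiny_set tT0.
have [rho [rN rid rmem rpair]] := reflect_set theta_cardinal nt N1 Ncl Tt.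
have Tst : structure_of K ∈ T by apply/TE; left.
have Tun : underlying_set K ∈ T by apply/TE; right; left.
have Tin : interp_fun K ∈ T by apply/TE; do 2 right; left.
have Tco f : code f ∈ T by apply/TE; do 3 right; left; exists f.
have Tint f : interp K f ∈ T by apply/TE; do 4 right; left; exists f.
have Tci f : vpair (code f) (interp K f) ∈ T by apply/TE; do 5 right; left; exists f.
have TS a : S a -> a ∈ T by move=> Sa; apply/TE; do 6 right; left.
have T2 a b : S a -> S b -> vpair a b ∈ T.
  move=> Sa Sb; apply/TE; do 7 right; left.
  by exists (exist _ a Sa, exist _ b Sb).
have T3 a b c : S a -> S b -> S c -> vpair (vpair a b) c ∈ T.
  move=> Sa Sb Sc; apply/TE; do 8 right.
  by exists (exist _ a Sa, exist _ b Sb, exist _ c Sc).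
have [rU rJ] : rho (underlying_set K) = underlying_set K /\
    rho (interp_fun K) = interp_fun K.
  have := rpair _ _ _ Tst Tun Tin erefl; rewrite (rid _ Tst KN).
  by move=> /esym/vpair_inj.
have rcode f : rho (code f) = code f.
  by apply: rid => //; apply: Nsig; apply/signatureE; exists f.
have rint f : rho (interp K f) = interp K f.
  have : vpair (code f) (interp K f) ∈ interp_fun K by apply/interp_funE; exists f.
  move=> /(rmem _ _ (Tci f) Tin); rewrite rJ (rpair _ _ _ (Tci f) (Tco f) (Tint f) erefl).
  by rewrite rcode => /interp_funE[g /vpair_inj[/symbol_code_inj <-]].
have r2 f a b : S a -> S b -> vpair a b ∈ interp K f ->
    vpair (rho a) (rho b) ∈ interp K f.
  move=> Sa Sb /(rmem _ _ (T2 _ _ Sa Sb) (Tint f)); rewrite rint.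
  by rewrite (rpair _ _ _ (T2 _ _ Sa Sb) (TS _ Sa) (TS _ Sb) erefl).
(* Scaling by 1 shows that the sort is preserved. *)
have rel u (x : K u) : exists y : K u, S (kelt x) -> rho (kelt x) = kelt y.
  have [Sx|nSx] := pselect (S (kelt x)); last by exists x.
  have : vpair (kelt x) (kelt x) ∈ interp K (SScale (1 : R u)).
    by apply/interp_scaleE; exists x; rewrite scale1r.
  by move=> /(r2 _ _ _ Sx Sx) /interp_scaleE[y /vpair_inj[xy _]]; exists y.
pose r u (x : K u) := projT1 (cid (rel u x)).
have rE u (x : K u) : S (kelt x) -> kelt (r u x) = rho (kelt x).
  by move=> Sx; rewrite (projT2 (cid (rel u x))).
exists r; split.
- by move=> u x Sx; rewrite rE //; apply/rN/TS.
- by move=> u x Sx xN; apply: kelt_inj; rewrite rE // rid //; exact: TS.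
- move=> u x y Sx Sy Sxy; apply: kelt_inj; rewrite rE //.
  have : vpair (vpair (kelt x) (kelt y)) (kelt (x + y)) ∈ interp K (SAdd u).
    by apply/interp_addE; exists x, y.
  move=> /(rmem _ _ (T3 _ _ _ Sx Sy Sxy) (Tint _)); rewrite rint.
  rewrite (rpair _ _ _ (T3 _ _ _ Sx Sy Sxy) (T2 _ _ Sx Sy) (TS _ Sxy) erefl).
  rewrite (rpair _ _ _ (T2 _ _ Sx Sy) (TS _ Sx) (TS _ Sy) erefl).
  move=> /interp_addE[x' [y' /vpair_inj[/vpair_inj[]]]].
  by rewrite -!rE // => /kelt_inj<- /kelt_inj<-.
- move=> u a x Sx Sax; apply: kelt_inj; rewrite rE //.
  have : vpair (kelt x) (kelt (a *: x)) ∈ interp K (SScale a).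
    by apply/interp_scaleE; exists x.
  move=> /(r2 _ _ _ Sx Sax)/interp_scaleE[x' /vpair_inj[]].
  by rewrite -(rE _ x) // => /kelt_inj<-.
- move=> u v a x Sx Sax; apply: kelt_inj; rewrite rE //.
  have : vpair (kelt x) (kelt (rmap K a x)) ∈ interp K (SArr a).
    by apply/interp_arrE; exists x.
  move=> /(r2 _ _ _ Sx Sax)/interp_arrE[x' /vpair_inj[]].
  by rewrite -(rE _ x) // => /kelt_inj<-.
Qed.

(** The trace is closed under an operation because a retraction that is defined
    at the arguments and at the value fixes the arguments, hence the value. *)
Lemma traceD u (x y : K u) : trace N x -> trace N y -> trace N (x + y).
Proof.
move=> xN yN; have nt := nat_theta.
have [|rho rP] := @retract_exists ([set kelt x] `|` ([set kelt y] `|` [set kelt (x + y)])).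
  by do 2 (apply: (tiny_setU nt); first exact: (tiny_set1 nt)); exact: (tiny_set1 nt).
have Sx : ([set kelt x] `|` ([set kelt y] `|` [set kelt (x + y)])) (kelt x) by left.
have Sy : ([set kelt x] `|` ([set kelt y] `|` [set kelt (x + y)])) (kelt y) by right; left.
have Sxy : ([set kelt x] `|` ([set kelt y] `|` [set kelt (x + y)])) (kelt (x + y)) by right; right.
have := retrN rP Sxy; rewrite (retrD rP Sx Sy Sxy).
by rewrite (retr_id rP Sx xN) (retr_id rP Sy yN).
Qed.

Lemma traceZ u (r : R u) (x : K u) : trace N x -> trace N (r *: x).
Proof.
move=> xN; have nt := nat_theta.
have [|rho rP] := @retract_exists ([set kelt x] `|` [set kelt (r *: x)]).
  by apply: (tiny_setU nt); exact: (tiny_set1 nt).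
have Sx : ([set kelt x] `|` [set kelt (r *: x)]) (kelt x) by left.
have Sy : ([set kelt x] `|` [set kelt (r *: x)]) (kelt (r *: x)) by right.
by have := retrN rP Sy; rewrite (retrZ rP Sx Sy) (retr_id rP Sx xN).
Qed.

Lemma trace0 u : trace N (0 : K u).
Proof.
have [|rho rP] := @retract_exists [set kelt (0 : K u)]; first exact: (tiny_set1 nat_theta).
have S0 : [set kelt (0 : K u)] (kelt (0 *: 0 : K u)) by rewrite /= scale0r.
have := retrN rP S0; rewrite (retrZ rP _ S0) ?scale0r //.
Qed.

Lemma traceA u v (a : El (hom u v)) (x : K u) : trace N x -> trace N (rmap K a x).
Proof.
move=> xN; have nt := nat_theta.
have [|rho rP] := @retract_exists ([set kelt x] `|` [set kelt (rmap K a x)]).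
  by apply: (tiny_setU nt); exact: (tiny_set1 nt).
have Sx : ([set kelt x] `|` [set kelt (rmap K a x)]) (kelt x) by left.
have Sy : ([set kelt x] `|` [set kelt (rmap K a x)]) (kelt (rmap K a x)) by right.
by have := retrN rP Sy; rewrite (retrA rP Sx Sy) (retr_id rP Sx xN).
Qed.

End Retract.
End Symbols.

End Signatures.

(** * Relations in tensor products *)

Section Tensors.
Local Open Scope ring_scope.
Local Open Scope quotient_scope.
Import GRing.Theory.
Import Quotient.

Section TensorSums.
Variables (A : pzRingType) (Q : lmodType A^c) (M : lmodType A).

Definition tclass (x : {freeg (Q * M)}) : tens Q M := \pi_{quot (@tens_sub A Q M)} x.

Lemma tclassD x y : tclass (x + y) = tclass x + tclass y.
Proof. exact: (@pi_addr _ _ _ _ _ {quot (@tens_sub A Q M)} x y). Qed.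

Lemma tclassN x : tclass (- x) = - tclass x.
Proof. exact: (@pi_oppr _ _ _ _ _ {quot (@tens_sub A Q M)} x). Qed.

Lemma tclassB x y : tclass (x - y) = tclass x - tclass y.
Proof. by rewrite tclassD tclassN. Qed.

Lemma tclass0 : tclass 0 = 0.
Proof. by have := tclassB 0 0; rewrite !subrr. Qed.

Lemma tclass_eq0 x : tclass x = 0 <-> tens_rel x.
Proof.
rewrite -tclass0; split=> [e|r].
  have : x - 0 \in @tens_sub A Q M by rewrite idealrBE; apply/eqP.
  by rewrite subr0 => /asboolP.
have : x - 0 \in @tens_sub A Q M by apply/asboolP; rewrite subr0.
by rewrite idealrBE => /eqP.
Qed.

Lemma tclass_eq x y : tens_rel (x - y) -> tclass x = tclass y.
Proof. by move=> /tclass_eq0/eqP; rewrite tclassB subr_eq0 => /eqP. Qed.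

Lemma tpureE (q : Q) (m : M) : tpure q m = tclass (tgen q m). Proof. by []. Qed.

Lemma tpureDl q q' m : tpure (q + q') m = tpure q m + tpure q' m :> tens Q M.
Proof. by rewrite !tpureE -tclassD; apply: tclass_eq; exact: tens_relDl. Qed.

Lemma tpureDr q m m' : tpure q (m + m') = tpure q m + tpure q m' :> tens Q M.
Proof. by rewrite !tpureE -tclassD; apply: tclass_eq; exact: tens_relDr. Qed.

Lemma tpureZ q (a : A) m :
  tpure ((a : A^c) *: q) m = tpure q (a *: m) :> tens Q M.
Proof. by rewrite !tpureE; apply: tclass_eq; exact: tens_relZ. Qed.

Lemma tpure0l m : tpure 0 m = 0 :> tens Q M.
Proof. by apply: (addrI (tpure 0 m)); rewrite -tpureDl !addr0. Qed.

Lemma tpureNl q m : tpure (- q) m = - tpure q m :> tens Q M.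
Proof. by apply: (addrI (tpure q m)); rewrite -tpureDl !subrr tpure0l. Qed.

Definition tsum (s : seq (Q * M)) : tens Q M := \sum_(p <- s) tpure p.1 p.2.

Lemma tsum_cat s t : tsum (s ++ t) = tsum s + tsum t.
Proof. by rewrite /tsum big_cat. Qed.

Lemma tsum_opp s : tsum [seq (- p.1, p.2) | p <- s] = - tsum s.
Proof.
rewrite /tsum big_map raddf_sum; apply: eq_bigr => p _; exact: tpureNl.
Qed.

Lemma tsum_gen s : tsum s = tclass (\sum_(p <- s) tgen p.1 p.2).
Proof.
elim: s => [|p s IH]; first by rewrite /tsum !big_nil tclass0.
by rewrite /tsum !big_cons tclassD -IH.
Qed.

Lemma tens_tsum (t : tens Q M) : exists s, t = tsum s.
Proof.
rewrite -[t]reprK; move: (repr t) => {t} x; rewrite -/(tclass x).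
suff gen k p : exists s, tclass << k *g p >> = tsum s.
  rewrite -[x]freeg_sumE; elim: (dom x) => [|p s [s' IH]].
    by exists [::]; rewrite /tsum !big_nil tclass0.
  have [s1 e1] := gen (coeff p x) p; exists (s1 ++ s').
  by rewrite big_cons tclassD e1 IH tsum_cat.
have gn (n : nat) : exists s, tclass << n%:Z *g p >> = tsum s.
  elim: n => [|n [s IH]]; first by exists [::]; rewrite freegU0 tclass0 /tsum big_nil.
  exists (p :: s); rewrite -add1n PoszD -freegUD tclassD IH.
  by rewrite /tsum big_cons; case: p {IH}.
case: k => n; first exact: gn.
have [s e] := gn n.+1; exists [seq (- p.1, p.2) | p <- s].
by rewrite tsum_opp -e NegzE -freegUN tclassN.
Qed.

End TensorSums.

Section TensorMaps.
Variables (A : pzRingType).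

(** A predicate, because [tens_map] takes plain functions, such as [id]. *)
Definition is_linear (B : pzRingType) (M M' : lmodType B) (f : M -> M') :=
  (forall x y, f (x + y) = f x + f y) /\ (forall a x, f (a *: x) = a *: f x).

Lemma balanced_map (Q Q' : lmodType A^c) (M M' : lmodType A)
    (f : Q -> Q') (g : M -> M') : is_linear f -> is_linear g ->
  balanced (fun q m => tpure (f q) (g m)).
Proof.
move=> [fD fZ] [gD gZ]; split=> [q q' m|q m m'|q a m].
- by rewrite fD tpureDl.
- by rewrite gD tpureDr.
- by rewrite fZ gZ tpureZ.
Qed.

Lemma lift_tsum (Q : lmodType A^c) (M : lmodType A) (Z : zmodType) (b : Q -> M -> Z) s :
  balanced b -> tens_lift b (tsum s) = \sum_(p <- s) b p.1 p.2.
Proof.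
move=> bb; have l0 : tens_lift b 0 = 0.
  by apply: (addrI (tens_lift b 0)); rewrite -tens_liftD // !addr0.
elim: s => [|p s IH]; first by rewrite /tsum !big_nil.
by rewrite /tsum !big_cons tens_liftD // tens_liftE // -/(tsum s) IH.
Qed.

Lemma map_tsum (Q Q' : lmodType A^c) (M M' : lmodType A)
    (f : Q -> Q') (g : M -> M') s : is_linear f -> is_linear g ->
  tens_map f g (tsum s) = tsum [seq (f p.1, g p.2) | p <- s].
Proof.
move=> fl gl; rewrite /tens_map lift_tsum; last exact: balanced_map.
by rewrite /tsum big_map.
Qed.

Lemma is_linear_linear (B : pzRingType) (M M' : lmodType B)
  (f : {linear M -> M'}) : is_linear f.
Proof. by split=> [x y|a x]; rewrite ?linearD ?linearZ. Qed.

Variables (Q : lmodType A^c) (M : lmodType A).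

(** [D] and [E] list the instances of additivity and of homogeneity on which a
    computation in a tensor product relies. *)
Definition respects (D : seq (M * M)) (E : seq (A * M)) (M' : lmodType A)
    (rho : M -> M') :=
  (forall p, p \in D -> rho (p.1 + p.2) = rho p.1 + rho p.2) /\
  (forall p, p \in E -> rho (p.1 *: p.2) = p.1 *: rho p.2).

(** Defined on the free group, hence additive for any [rho]; linearity of [rho]
    is what the descent to the tensor product would require. *)
Definition tpush (M' : lmodType A) (rho : M -> M') (x : {freeg (Q * M)}) : tens Q M' :=
  fglift (fun p : Q * M => tpure p.1 (rho p.2) : zmodule (tens Q M')) x.

Section Push.
Variables (M' : lmodType A) (rho : M -> M').

Lemma tpushB x y : tpush rho (x - y) = tpush rho x - tpush rho y.
Proof. exact: (@lift_is_additive int _ (zmodule (tens Q M'))). Qed.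

Lemma tpush0 : tpush rho 0 = 0.
Proof. by have := tpushB 0 0; rewrite !subrr. Qed.

Lemma tpushD x y : tpush rho (x + y) = tpush rho x + tpush rho y.
Proof. by rewrite -{1}[y]opprK -[- y]sub0r !tpushB tpush0 sub0r opprK. Qed.

Lemma tpush_gen q m : tpush rho (tgen q m) = tpure q (rho m).
Proof. by rewrite /tpush /tgen liftU scale1r. Qed.

Lemma tpush_sum s : tpush rho (\sum_(p <- s) tgen p.1 p.2) =
  tsum [seq (p.1, rho p.2) | p <- s].
Proof.
rewrite /tsum big_map; elim: s => [|p s IH]; first by rewrite !big_nil tpush0.
by rewrite !big_cons tpushD tpush_gen IH.
Qed.
End Push.

(** A derivation from the defining relations uses finitely many of them, and
    those that concern only the first variable survive any map of the second. *)
Lemma tens_rel_respects x : @tens_rel A Q M x -> exists D E,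
  forall (M' : lmodType A) (rho : M -> M'), respects D E rho -> tpush rho x = 0.
Proof.
elim=> {x}.
- by exists [::], [::] => M' rho _; exact: tpush0.
- move=> x y _ [D [E h]] _ [D' [E' h']]; exists (D ++ D'), (E ++ E') => M' rho [rD rE].
  rewrite tpushB h ?h' ?subrr //.
    by split=> p pi; [apply: rD|apply: rE]; rewrite mem_cat pi ?orbT.
  by split=> p pi; [apply: rD|apply: rE]; rewrite mem_cat pi ?orbT.
- move=> q q' m; exists [::], [::] => M' rho _.
  by rewrite tpushB tpushD !tpush_gen tpureDl subrr.
- move=> q m m'; exists [:: (m, m')], [::] => M' rho [rD _].
  by rewrite tpushB tpushD !tpush_gen (rD _ (mem_head _ _)) tpureDr subrr.
- move=> q a m; exists [::], [:: (a, m)] => M' rho [_ rE].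
  by rewrite tpushB !tpush_gen (rE _ (mem_head _ _)) tpureZ subrr.
Qed.

Lemma tsum0_respects s : tsum s = 0 :> tens Q M -> exists D E,
  forall (M' : lmodType A) (rho : M -> M'), respects D E rho ->
    tsum [seq (p.1, rho p.2) | p <- s] = 0 :> tens Q M'.
Proof.
rewrite tsum_gen => /tclass_eq0/tens_rel_respects[D [E h]].
by exists D, E => M' rho /h <-; rewrite tpush_sum.
Qed.

(** The shape of a finite family of relations: variables, which are natural
    numbers, replace the elements of a module, so that shapes can be counted
    independently of the size of the module. *)
Definition named_rels : Type := seq (nat * nat * nat) * seq (A * nat * nat).

Definition holds (r : named_rels) (M' : lmodType A) (nu : nat -> M') :=
  (forall t, t \in r.1 -> nu t.1.1 + nu t.1.2 = nu t.2) /\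
  (forall t, t \in r.2 -> t.1.1 *: nu t.1.2 = nu t.2).

(** The variables are the positions in a list of the elements that occur in [s]
    or in the relations that [tsum0_respects] provides. *)
Lemma tsum0_named s : tsum s = 0 :> tens Q M -> exists (d : seq nat * named_rels)
  (nu : nat -> M), [/\ holds d.2 nu, [seq nu n | n <- d.1] = [seq p.2 | p <- s] &
    forall (M' : lmodType A) (nu' : nat -> M'), holds d.2 nu' ->
      tsum (zip [seq p.1 | p <- s] [seq nu' n | n <- d.1]) = 0 :> tens Q M'].
Proof.
move=> /tsum0_respects[D [E h]].
pose l := [seq p.2 | p <- s] ++ flatten [seq [:: p.1; p.2; p.1 + p.2] | p <- D]
  ++ flatten [seq [:: p.2; p.1 *: p.2] | p <- E].
pose nu n := nth 0 l n; pose nm m := index m l.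
have nuK m : m \in l -> nu (nm m) = m by exact: nth_index.
have ls p : p \in s -> p.2 \in l by move=> ps; rewrite mem_cat map_f.
have lD p m : p \in D -> m \in [:: p.1; p.2; p.1 + p.2] -> m \in l.
  move=> pD pm; rewrite !mem_cat; apply/orP; right; apply/orP; left.
  by apply/flatten_mapP; exists p.
have lE p m : p \in E -> m \in [:: p.2; p.1 *: p.2] -> m \in l.
  move=> pE pm; rewrite !mem_cat; apply/orP; right; apply/orP; right.
  by apply/flatten_mapP; exists p.
exists ([seq nm p.2 | p <- s], ([seq (nm p.1, nm p.2, nm (p.1 + p.2)) | p <- D],
  [seq (p.1, nm p.2, nm (p.1 *: p.2)) | p <- E])), nu; split.
- split=> t /mapP[p pi ->] /=.
    by rewrite !nuK // (lD p) // !inE eqxx ?orbT.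
  by rewrite !nuK // (lE p) // !inE eqxx ?orbT.
- by rewrite -map_comp; apply/eq_in_map => p /ls pl; exact: nuK.
move=> M' nu' [/= hD hE]; rewrite -map_comp zip_map.
apply: (h M' (nu' \o nm)); split=> p pi /=.
  by rewrite (hD _ (map_f (fun p => (nm p.1, nm p.2, nm (p.1 + p.2))) pi)).
by rewrite -(hE _ (map_f (fun p => (p.1, nm p.2, nm (p.1 *: p.2))) pi)).
Qed.

End TensorMaps.

End Tensors.

(** * Purity and its consequences *)

Section Purity.
Local Open Scope ring_scope.
Import GRing.Theory.

Lemma inj_surj_bij (T U : Type) (f : T -> U) : injective f ->
  (forall y, exists x, f x = y) -> bijective f.
Proof. by move=> fi /choice[g gP]; exists g => // x; apply: fi. Qed.

Lemma additive_inj (T U : zmodType) (f : T -> U) :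
  (forall x y, f (x + y) = f x + f y) -> (forall x, f x = 0 -> x = 0) -> injective f.
Proof.
move=> fD f0 x y e; apply/eqP; rewrite -subr_eq0; apply/eqP/f0.
by apply: (addIr (f y)); rewrite -fD subrK add0r.
Qed.

Section Pure.
Variables (V : zfc) (R : diagram V) (theta : V).
Local Notation O := (El (obj R)).
Hypotheses (nt : embeds nat (El theta)) (sq : embeds (El theta * El theta) (El theta))
  (Rt : forall u : O, embeds (R u) (El theta)).
Variables (L K C : rmodule R) (inc : rhom L K) (prj : rhom K C).
Hypotheses (prjS : forall u c, exists x, prj u x = c)
  (prj0 : forall u x, prj u x = 0 <-> exists l, inc u l = x).

(** A linear map from the submodule [S] to [L] that fixes their common elements;
    it is given by total functions to avoid subtypes. *)
Record partial_retract (S : forall u, set (K u)) (rho : forall u, K u -> L u) : Prop :=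
PartialRetract {
  prS0 : forall u, S u 0;
  prSD : forall u x y, S u x -> S u y -> S u (x + y);
  prSZ : forall u (r : R u) x, S u x -> S u (r *: x);
  prSA : forall u v (a : El (hom u v)) x, S u x -> S v (rmap K a x);
  prD : forall u x y, S u x -> S u y -> rho u (x + y) = rho u x + rho u y;
  prZ : forall u (r : R u) x, S u x -> rho u (r *: x) = r *: rho u x;
  prA : forall u v (a : El (hom u v)) x, S u x -> rho v (rmap K a x) = rmap L a (rho u x);
  prI : forall u l, S u (inc u l) -> rho u (inc u l) = l
}.

Definition pure_substructure := forall I (F : I -> {u : O & K u}), embeds I (El theta) ->
  exists S rho, partial_retract S rho /\ forall j, S (tag (F j)) (tagged (F j)).

Hypothesis pure : pure_substructure.

Lemma pure_seq2 u (l : seq (K u)) v (l' : seq (K v)) : exists S rho,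
  [/\ partial_retract S rho, forall x, x \in l -> S u x & forall x, x \in l' -> S v x].
Proof.
pose F (n : nat + nat) := match n with
  | inl n => existT (fun u : O => vmod_lmod (K u)) u (nth 0 l n)
  | inr n => existT _ v (nth 0 l' n) end.
have [|S [rho [pr h]]] := pure F; first exact: embeds_absorb_sum.
exists S, rho; split=> // x xl.
  by rewrite -(nth_index 0 xl); exact: (h (inl (index x l))).
by rewrite -(nth_index 0 xl); exact: (h (inr (index x l'))).
Qed.

Lemma pure_seq u (l : seq (K u)) : exists S rho,
  partial_retract S rho /\ forall x, x \in l -> S u x.
Proof. by have [S [rho [pr Sl _]]] := pure_seq2 l l; exists S, rho. Qed.

Section Partial.
Variables (S : forall u, set (K u)) (rho : forall u, K u -> L u).
Arguments S : clear implicits.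
Arguments rho : clear implicits.
Hypothesis pr : partial_retract S rho.

Lemma pr0 u : rho u 0 = 0.
Proof. rewrite -{1}(linear0 (inc u)) (prI pr) // linear0; exact: (prS0 pr u). Qed.

Lemma prSN u x : S u x -> S u (- x).
Proof. by rewrite -scaleN1r; exact: (prSZ pr). Qed.

Lemma pr_respects u (D : seq (K u * K u)) (E : seq (R u * K u)) :
  (forall x, x \in [seq p.1 | p <- D] ++ [seq p.2 | p <- D] ++ [seq p.2 | p <- E] ->
     S u x) ->
  respects D E (rho u).
Proof.
move=> SDE; split=> p pi.
  by rewrite (prD pr) //; apply: SDE; rewrite !mem_cat map_f ?orbT.
by rewrite (prZ pr) //; apply: SDE; rewrite !mem_cat map_f ?orbT.
Qed.

Variables (u : O) (lift : C u -> K u).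
Hypothesis liftK : forall c, prj u (lift c) = c.

(** A section of [prj u] that does not depend on the lifts, as long as these are
    in [S]. *)
Definition splitting (c : C u) : K u := lift c - inc u (rho u (lift c)).

Lemma prj_inc l : prj u (inc u l) = 0. Proof. by apply/prj0; exists l. Qed.

Lemma splittingK c : prj u (splitting c) = c.
Proof. by rewrite /splitting linearB liftK prj_inc subr0. Qed.

Lemma retract_inc (x : K u) : S u x -> prj u x = 0 -> inc u (rho u x) = x.
Proof. by move=> Sx /prj0[l lx]; rewrite -lx in Sx *; rewrite (prI pr). Qed.

Lemma retractB (x y : K u) : S u x -> S u y -> rho u (x - y) = rho u x - rho u y.
Proof.
move=> Sx Sy; rewrite -scaleN1r (prD pr) // ?(prZ pr) ?scaleN1r //.
by apply: prSN.
Qed.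

(** The difference [x - y] is in the image of [inc u], so the retraction fixes
    it. *)
Lemma splitting_eq (x y : K u) : S u x -> S u y -> prj u x = prj u y ->
  x - inc u (rho u x) = y - inc u (rho u y).
Proof.
move=> Sx Sy xy; have : inc u (rho u (x - y)) = x - y.
  apply: retract_inc; last by rewrite linearB xy subrr.
  by apply: (prSD pr) => //; apply: prSN.
rewrite retractB // linearB.
move: (inc u (rho u x)) (inc u (rho u y)) => a b e.
by rewrite -[x](subrK y) -e addrAC [a - b]addrC addrK addrC.
Qed.

Lemma splittingD c c' : S u (lift c) -> S u (lift c') -> S u (lift (c + c')) ->
  splitting (c + c') = splitting c + splitting c'.
Proof.
move=> Sc Sc' Scc'; rewrite /splitting.
rewrite (splitting_eq (y := lift c + lift c')) //.
- by rewrite (prD pr) // linearD opprD addrACA.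
- exact: (prSD pr).
by rewrite linearD !liftK.
Qed.

Lemma splittingZ r c : S u (lift c) -> S u (lift (r *: c)) ->
  splitting (r *: c) = r *: splitting c.
Proof.
move=> Sc Src; rewrite /splitting.
rewrite (splitting_eq (y := r *: lift c)) //.
- by rewrite (prZ pr) // linearZ scalerBr.
- exact: (prSZ pr).
by rewrite linearZ /= !liftK.
Qed.

End Partial.

Lemma inc_like u : is_linear (inc u). Proof. exact: is_linear_linear. Qed.
Lemma prj_like u : is_linear (prj u). Proof. exact: is_linear_linear. Qed.

Section At.
Variable u : O.
Notation A := (R u).

(** The finitely many instances of linearity that prove the equation over [K]
    hold between elements of some [S], where [rho] preserves them. *)
Lemma tsum_retract (Q : lmodType A^c) (s : seq (Q * K u)) (s' : seq (Q * L u)) :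
  tsum s = tsum [seq (p.1, inc u p.2) | p <- s'] :> tens Q (K u) ->
  exists S rho, [/\ partial_retract S rho, forall p, p \in s -> S u p.2 &
    tsum [seq (p.1, rho u p.2) | p <- s] = tsum s' :> tens Q (L u)].
Proof.
move=> e; have /tsum0_respects[D [E h]] :
    tsum (s ++ [seq (- p.1, p.2) | p <- [seq (p.1, inc u p.2) | p <- s']]) = 0
      :> tens Q (K u) by rewrite tsum_cat tsum_opp e subrr.
have [S [rho [pr SP]]] := pure_seq (([seq p.1 | p <- D] ++ [seq p.2 | p <- D] ++
  [seq p.2 | p <- E]) ++ [seq p.2 | p <- s] ++ [seq inc u p.2 | p <- s']).
exists S, rho; split=> //.
  by move=> p ps; apply: SP; rewrite !mem_cat (map_f _ ps) ?orbT.
have hr : respects D E (rho u).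
  by apply: (pr_respects pr) => x xDE; apply: SP; rewrite mem_cat xDE.
have /eqP := h (L u) (rho u) hr; rewrite map_cat tsum_cat addr_eq0 => /eqP ->.
rewrite -!map_comp.
rewrite -tsum_opp -map_comp; congr tsum; rewrite -[RHS]map_id.
apply/eq_in_map => p ps /=; rewrite (prI pr) ?opprK //; first by case: p {ps}.
by apply: SP; rewrite !mem_cat (map_f (fun p => inc u p.2) ps) !orbT.
Qed.

Lemma splitting_exists (s : seq (C u)) : exists S rho (lift : C u -> K u),
  [/\ partial_retract S rho, forall c, prj u (lift c) = c &
      forall c, c \in s -> S u (lift c)].
Proof.
have [lift liftK] := choice (@prjS u).
have [S [rho [pr SP]]] := pure_seq (map lift s).
by exists S, rho, lift; split=> // c cs; apply: SP; exact: map_f.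
Qed.

(** A relation over [C] is proved by finitely many instances of linearity, which
    [splitting] respects. *)
Lemma tsum_split (Q : lmodType A^c) (s : seq (Q * C u)) :
  tsum s = 0 :> tens Q (C u) -> exists lam : C u -> K u,
    (forall c, prj u (lam c) = c) /\
    tsum [seq (p.1, lam p.2) | p <- s] = 0 :> tens Q (K u).
Proof.
move=> /tsum0_respects[D [E h]].
have [S [rho [lift [pr liftK SP]]]] := splitting_exists (
  [seq p.1 | p <- D] ++ [seq p.2 | p <- D] ++ [seq p.1 + p.2 | p <- D] ++
  [seq p.2 | p <- E] ++ [seq p.1 *: p.2 | p <- E]).
exists (splitting rho lift); split; first by move=> c; exact: splittingK.
apply: h; split=> p pi.
  apply: (splittingD pr) => //; apply: SP; rewrite !mem_cat.
  - by rewrite (map_f (fun p => p.1) pi).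
  - by rewrite (map_f (fun p => p.2) pi) !orbT.
  - by rewrite (map_f (fun p => p.1 + p.2) pi) !orbT.
apply: (splittingZ pr) => //; apply: SP; rewrite !mem_cat.
- by rewrite (map_f (fun p => p.2) pi) !orbT.
- by rewrite (map_f (fun p => p.1 *: p.2) pi) !orbT.
Qed.

Lemma map_prj_split (Q : lmodType A^c) (s : seq (Q * C u)) (lam : C u -> K u) :
  (forall c, prj u (lam c) = c) ->
  tens_map id (prj u) (tsum [seq (p.1, lam p.2) | p <- s] : tens Q (K u)) = tsum s.
Proof.
move=> lamK; rewrite map_tsum //; last exact: prj_like.
rewrite -map_comp; congr tsum; rewrite -[RHS]map_id; apply: eq_map => p /=.
by rewrite lamK; case: p.
Qed.

Lemma flat_im_ker (M : lmodType A) (X Y Z : vmod V A^c) (f : {linear X -> Y})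
    (g : {linear Y -> Z}) : exact_at f g -> forall t : tens X M,
  tens_map g id (tens_map f id t : tens Y M) = 0 :> tens Z M.
Proof.
move=> fg t; have [s ->] := tens_tsum t.
rewrite !map_tsum //; try exact: is_linear_linear.
rewrite -map_comp /tsum big_map big1 // => p _ /=.
by rewrite (_ : g (f p.1) = 0) ?tpure0l //; apply/fg; exists p.1.
Qed.

(** Flatness of [K] provides a preimage over [K], which is moved to [L]. *)
Lemma flat_sub : flat_left V (K u) -> flat_left V (L u).
Proof.
move=> flK X Y Z f g fg y; split=> [|[t <-]]; last exact: flat_im_ker.
have fl := is_linear_linear f; have gl := is_linear_linear g.
have [s ->] := tens_tsum y; rewrite map_tsum // => gs.
have [|t /= tE] := (flK X Y Z f g fg (tsum [seq (p.1, inc u p.2) | p <- s])).1.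
  rewrite map_tsum // -map_comp.
  have <- : tens_map id (inc u) (tsum [seq (g p.1, p.2) | p <- s] : tens Z (L u)) = 0
    :> tens Z (K u).
    rewrite gs (_ : 0 = tsum [::] :> tens Z (L u)); last by rewrite /tsum big_nil.
    by rewrite map_tsum //; [rewrite /tsum big_nil|exact: inc_like].
  by rewrite map_tsum //; [rewrite -map_comp|exact: inc_like].
have [r rE] := tens_tsum t; rewrite rE map_tsum // in tE.
have [S [rho [pr _ <-]]] := tsum_retract tE.
exists (tsum [seq (p.1, rho u p.2) | p <- r]); rewrite map_tsum // -!map_comp.
by [].
Qed.

(** The kernel condition is lifted to [K], where flatness provides a preimage;
    its image over [C] is the required one. *)
Lemma flat_quotient : flat_left V (K u) -> flat_left V (C u).
Proof.
move=> flK X Y Z f g fg y; split=> [|[t <-]]; last exact: flat_im_ker.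
have fl := is_linear_linear f; have gl := is_linear_linear g.
have [s ->] := tens_tsum y; rewrite map_tsum // => /tsum_split[lam [lamK gs]].
have [|t /= tE] := (flK X Y Z f g fg (tsum [seq (p.1, lam p.2) | p <- s])).1.
  by rewrite map_tsum // -map_comp -gs -map_comp.
exists (tens_map id (prj u) t); rewrite -(map_prj_split s lamK) -tE.
have [r ->] := tens_tsum t.
by rewrite !map_tsum //; try exact: prj_like; rewrite -!map_comp.
Qed.

Section Products.
Variables (I : Type) (Q : I -> lmodType A^c).

Lemma tens_prod_tsum (M : lmodType A) (s : seq ((prodmod Q : lmodType A^c) * M)) i :
  tens_prod (tsum s) i = tsum [seq (p.1 i, p.2) | p <- s].
Proof. by rewrite /tens_prod map_tsum. Qed.

Lemma tens_prodD (M : lmodType A) (t t' : tens (prodmod Q) M) i :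
  tens_prod (t + t') i = tens_prod t i + tens_prod t' i.
Proof. by rewrite /tens_prod /tens_map tens_liftD //; exact: balanced_map. Qed.

Lemma tens_prod_inj (M : lmodType A) :
  (forall s : seq ((prodmod Q : lmodType A^c) * M),
     (forall i, tsum [seq (p.1 i, p.2) | p <- s] = 0 :> tens (Q i) M) ->
     tsum s = 0 :> tens (prodmod Q) M) <->
  injective (@tens_prod A I Q M).
Proof.
split=> [h|inj s hs].
  move=> t t' e; apply/eqP; rewrite -subr_eq0; apply/eqP.
  have [s sE] := tens_tsum (t - t'); rewrite sE; apply: h => i.
  rewrite -tens_prod_tsum -sE; apply: (addIr (tens_prod t' i)).
  by rewrite -tens_prodD subrK add0r e.
apply: inj; apply: functional_extensionality_dep => i; rewrite tens_prod_tsum hs.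
rewrite (_ : 0 = tsum [::] :> tens (prodmod Q) M); last by rewrite /tsum big_nil.
by rewrite tens_prod_tsum /tsum big_nil.
Qed.
End Products.

Lemma mittag_leffler_sub : mittag_leffler V (K u) -> mittag_leffler V (L u).
Proof.
move=> mlK I Q; apply/tens_prod_inj => s hs.
have /tens_prod_inj mlKQ := mlK I Q.
have e : tsum [::] = tsum [seq (p.1, inc u p.2) | p <- s] :> tens (prodmod Q) (K u).
  rewrite /tsum big_nil; symmetry; apply: mlKQ => i; rewrite -map_comp.
  rewrite (_ : 0 = tens_map id (inc u) (tsum [seq (p.1 i, p.2) | p <- s] : tens (Q i) (L u))).
    by rewrite map_tsum // -?map_comp //; exact: inc_like.
  rewrite hs (_ : 0 = tsum [::] :> tens (Q i) (L u)); last by rewrite /tsum big_nil.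
  by rewrite map_tsum //; [rewrite /tsum big_nil|exact: inc_like].
by have [S [rho [_ _ <-]]] := tsum_retract e; rewrite /tsum big_nil.
Qed.

Lemma data_theta : embeds (seq nat * named_rels A) (El theta).
Proof.
have pairs T U : embeds T (El theta) -> embeds U (El theta) -> embeds (T * U) (El theta).
  exact: embeds_absorb_prod.
have seqs T : embeds T (El theta) -> embeds (seq T) (El theta).
  exact: embeds_absorb_seq.
exact: (pairs _ _ (seqs _ nt) (pairs _ _ (seqs _ (pairs _ _ (pairs _ _ nt nt) nt))
  (seqs _ (pairs _ _ (pairs _ _ (Rt u) nt) nt)))).
Qed.

(** Each factor of the product has its own relations, but these have at most
    theta shapes [d]. A solution [val d] of each shape in [C] is chosen, and a
    single retraction is defined at the lifts of all of them. The resulting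
    [lam] turns these solutions into solutions in [K], with the same values at
    the second components of [s] for all factors. *)
Lemma mittag_leffler_quotient : mittag_leffler V (K u) -> mittag_leffler V (C u).
Proof.
move=> mlK I Q; apply/tens_prod_inj => s hs.
have /tens_prod_inj mlKQ := mlK I Q.
pose cs := [seq p.2 | p <- s].
pose good (d : seq nat * named_rels A) (nu : nat -> C u) :=
  holds d.2 nu /\ [seq nu n | n <- d.1] = cs.
have /choice[val valP] : forall d, exists nu, (exists nu', good d nu') -> good d nu.
  move=> d; have [[nu nuP]|h] := pselect (exists nu', good d nu'); first by exists nu.
  by exists (fun=> 0).
have [lift liftK] := choice (@prjS u).
pose F (x : (seq nat * named_rels A) * nat) :=
  existT (fun u : O => vmod_lmod (K u)) u (lift (val x.1 x.2)).
have [|S [rho [pr SF]]] := pure F; first exact: embeds_absorb_prod sq data_theta nt.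
have SP d n : S u (lift (val d n)) := SF (d, n).
pose lam := splitting rho lift.
rewrite -(map_prj_split s (lam := lam)); last by move=> c; exact: splittingK.
have -> : tsum [seq (p.1, lam p.2) | p <- s] = 0 :> tens (prodmod Q) (K u).
  apply: mlKQ => i; rewrite -map_comp.
  have [d [nu [hnu nus h]]] := tsum0_named (hs i).
  have [hv vs] : good d (val d).
    by apply: valP; exists nu; split=> //; rewrite nus -map_comp.
  have hl : holds d.2 (lam \o val d).
    case: hv => hD hE; split=> t ti /=.
      by rewrite -(hD _ ti) /lam (splittingD pr) // (hD _ ti).
    by rewrite -(hE _ ti) /lam (splittingZ pr) // (hE _ ti).
  rewrite -{}[RHS](h _ _ hl); congr tsum.
  rewrite (map_comp lam) vs /cs -!map_comp zip_map.
  by [].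
rewrite (_ : 0 = tsum [::] :> tens (prodmod Q) (K u)); last by rewrite /tsum big_nil.
by rewrite map_tsum //; [rewrite /tsum big_nil|exact: prj_like].
Qed.

End At.

Section QuasiCoherent.
Variables (u v : O) (a : El (hom u v)).
Notation Q := (rrestr (dmap a)).

Lemma ext_balanced (M : rmodule R) :
  balanced (fun (s : Q) (x : M u) => (s : R v) *: rmap M a x).
Proof.
split=> [q q' m|q m m'|q r m].
- exact: scalerDl.
- by rewrite linearD scalerDr.
- by rewrite linearZ /= scalerA.
Qed.

Lemma ext_tsum (M : rmodule R) (s : seq (Q * M u)) :
  ext_map (tsum s) = \sum_(p <- s) (p.1 : R v) *: rmap M a p.2.
Proof. by rewrite /ext_map lift_tsum //; exact: ext_balanced. Qed.

Lemma ext_bij (M : rmodule R) :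
  (forall s : seq (Q * M u), \sum_(p <- s) (p.1 : R v) *: rmap M a p.2 = 0 ->
     tsum s = 0 :> tens Q (M u)) /\
  (forall y, exists s : seq (Q * M u), \sum_(p <- s) (p.1 : R v) *: rmap M a p.2 = y) <->
  bijective (@ext_map V R M u v a).
Proof.
split=> [[h0 hs]|b].
  apply: inj_surj_bij => [|y]; last by have [s <-] := hs y; exists (tsum s); exact: ext_tsum.
  apply: additive_inj => [x y|x]; first by rewrite /ext_map tens_liftD //; exact: ext_balanced.
  by have [s ->] := tens_tsum x; rewrite ext_tsum; exact: h0.
have [g gK Kg] := b; split=> [s s0|y].
  apply: (bij_inj b); rewrite ext_tsum s0.
  rewrite (_ : 0 = tsum [::] :> tens Q (M u)); last by rewrite /tsum big_nil.
  by rewrite ext_tsum big_nil.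
by have [s sE] := tens_tsum (g y); exists s; rewrite -ext_tsum -sE Kg.
Qed.

Hypothesis bijK : bijective (@ext_map V R K u v a).

Lemma retract_ext S rho (s : seq (Q * K u)) : partial_retract S rho ->
  (forall p, p \in s -> S u p.2) ->
  S v (\sum_(p <- s) (p.1 : R v) *: rmap K a p.2) /\
  rho v (\sum_(p <- s) (p.1 : R v) *: rmap K a p.2) =
  \sum_(p <- s) (p.1 : R v) *: rmap L a (rho u p.2).
Proof.
move=> pr; elim: s => [|p s IH] Ss.
  by rewrite !big_nil (pr0 pr); split=> //; exact: (prS0 pr v).
have [|Sv rv] := IH; first by move=> q qs; apply: Ss; rewrite inE qs orbT.
have Sp : S u p.2 by apply: Ss; exact: mem_head.
have Sa := prSA pr a Sp; have Sr := prSZ pr (p.1 : R v) Sa.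
rewrite !big_cons (prD pr) // rv (prZ pr) // (prA pr) //.
by split=> //; exact: (prSD pr).
Qed.

(** The coefficients that express an element of [L v] over [K] express it over
    [L], once the retraction is applied to the elements of [K u]. *)
Lemma quasicoherent_sub : bijective (@ext_map V R L u v a).
Proof.
have [K0 KS] := (ext_bij K).2 bijK; apply/ext_bij; split=> [s s0|y].
  have e : tsum [::] = tsum [seq (p.1, inc u p.2) | p <- s] :> tens Q (K u).
    rewrite /tsum big_nil; symmetry; apply: K0; rewrite big_map /=.
    rewrite -[RHS](linear0 (inc v)) -s0 linear_sum; apply: eq_bigr => p _.
    by rewrite linearZ /= -rhom_nat.
  by have [S [rho [_ _ <-]]] := tsum_retract e; rewrite /tsum big_nil.
have [s sy] := KS (inc v y).
have [S [rho [pr Ss Sy]]] := pure_seq2 [seq p.2 | p <- s] [:: inc v y].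
have [|_] := retract_ext pr (s := s); first by move=> p ps; apply: Ss; exact: map_f.
rewrite sy (prI pr) => [yE|]; last by apply: Sy; exact: mem_head.
by exists [seq (p.1, rho u p.2) | p <- s]; rewrite big_map.
Qed.

Lemma quasicoherent_quotient : bijective (@ext_map V R C u v a).
Proof.
have [K0 KS] := (ext_bij K).2 bijK; apply/ext_bij; split=> [s s0|y]; last first.
  have [x <-] := prjS y; have [s <-] := KS x.
  exists [seq (p.1, prj u p.2) | p <- s]; rewrite big_map linear_sum.
  by apply: eq_bigr => p _; rewrite linearZ /= rhom_nat.
have [S [rho [lift [pr liftK SP]]]] := splitting_exists [seq p.2 | p <- s].
pose lam := splitting rho lift.
rewrite -(map_prj_split s (lam := lam)); last by move=> c; exact: splittingK.
have -> : tsum [seq (p.1, lam p.2) | p <- s] = 0 :> tens Q (K u).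
  apply: K0; rewrite big_map.
  pose t := [seq (p.1, lift p.2) | p <- s].
  have [|St rt] := retract_ext pr (s := t).
    by move=> _ /mapP[p ps ->]; apply: SP; exact: map_f.
  have pt : prj v (\sum_(p <- t) (p.1 : R v) *: rmap K a p.2) = 0.
    rewrite linear_sum big_map -[RHS]s0; apply: eq_bigr => p _.
    by rewrite linearZ /= rhom_nat liftK.
  have := retract_inc pr St pt; rewrite rt linear_sum !big_map => /esym/eqP.
  rewrite -subr_eq0 -sumrB => /eqP e; rewrite -[RHS]e; apply: eq_bigr => p _ /=.
  by rewrite /lam /splitting linearB /= scalerBr -rhom_nat [inc v (_ *: _)]linearZ.
rewrite (_ : 0 = tsum [::] :> tens Q (K u)); last by rewrite /tsum big_nil.
by rewrite map_tsum //; [rewrite /tsum big_nil|exact: prj_like].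
Qed.

End QuasiCoherent.

End Pure.

End Purity.

(** * Substructures and quotients of modules *)

Section Constructions.
Local Open Scope ring_scope.
Import GRing.Theory.

Definition mk_linear (A : pzRingType) (U : lmodType A) (W : zmodType)
    (s : GRing.Scale.law A W) (f : U -> W) (h : linear_for s f) : {linear U -> W | s} :=
  HB.pack f (GRing.isLinear.Build A U W s f h).

Section TransportInjection.
Variables (A : pzRingType) (M : lmodType A) (T : choiceType) (i : T -> M).
Hypotheses (iI : injective i) (i0 : exists t, i t = 0)
  (iD : forall t t', exists t'', i t'' = i t + i t')
  (iZ : forall a t, exists t', i t' = a *: i t).

(** An alias of [T] that carries the proofs, from which the instances recover
    the operations. *)
Definition inj_lmod of injective i & (exists t, i t = 0) &
  (forall t t', exists t'', i t'' = i t + i t') &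
  (forall a t, exists t', i t' = a *: i t) : Type := T.
Local Notation L := (inj_lmod iI i0 iD iZ).

Let zero : L := projT1 (cid i0).
Let add (t t' : L) : L := projT1 (cid (iD t t')).
Let scale a (t : L) : L := projT1 (cid (iZ a t)).
Let opp (t : L) : L := scale (-1) t.
Let zeroE : i zero = 0. Proof. exact: (projT2 (cid i0)). Qed.
Let addE t t' : i (add t t') = i t + i t'. Proof. exact: (projT2 (cid (iD t t'))). Qed.
Let scaleE a t : i (scale a t) = a *: i t. Proof. exact: (projT2 (cid (iZ a t))). Qed.

Let addA : associative add.
Proof. by move=> x y z; apply: iI; rewrite !addE addrA. Qed.
Let addC : commutative add.
Proof. by move=> x y; apply: iI; rewrite !addE addrC. Qed.
Let add0 : left_id zero add.
Proof. by move=> x; apply: iI; rewrite !addE zeroE add0r. Qed.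
Let addN : left_inverse zero opp add.
Proof. by move=> x; apply: iI; rewrite !addE scaleE scaleN1r addNr zeroE. Qed.

HB.instance Definition _ := Choice.on L.
HB.instance Definition _ := GRing.isZmodule.Build L addA addC add0 addN.

Let scaleA a b t : scale a (scale b t) = scale (a * b) t.
Proof. by apply: iI; rewrite !scaleE scalerA. Qed.
Let scale1 : left_id 1 scale.
Proof. by move=> t; apply: iI; rewrite scaleE scale1r. Qed.
Let scaleDr : right_distributive scale +%R.
Proof. by move=> a t u; apply: iI; rewrite !(scaleE, addE) scalerDr. Qed.
Let scaleDl t : {morph scale^~ t : a b / a + b}.
Proof. by move=> a b; apply: iI; rewrite !(scaleE, addE) scalerDl. Qed.

HB.instance Definition _ := GRing.Zmodule_isLmodule.Build A L
  scaleA scale1 scaleDr scaleDl.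

Lemma inj_lmod_linear : linear_for *:%R (i : L -> M).
Proof. by move=> a t u; rewrite addE scaleE. Qed.

End TransportInjection.

Section TransportSurjection.
Variables (A : pzRingType) (M : lmodType A) (T : choiceType) (p : M -> T).
Hypotheses (pS : forall t, exists x, p x = t)
  (pD : forall x x' y y', p x = p x' -> p y = p y' -> p (x + y) = p (x' + y'))
  (pZ : forall a x x', p x = p x' -> p (a *: x) = p (a *: x')).

(** An alias of [T] that carries the proofs, from which the instances recover
    the operations. *)
Definition surj_lmod of (forall t, exists x, p x = t) &
  (forall x x' y y', p x = p x' -> p y = p y' -> p (x + y) = p (x' + y')) &
  (forall a x x', p x = p x' -> p (a *: x) = p (a *: x')) : Type := T.
Local Notation L := (surj_lmod pS pD pZ).

Let lift (t : L) : M := projT1 (cid (pS t)).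
Let liftK t : p (lift t) = t. Proof. exact: (projT2 (cid (pS t))). Qed.
Let zero : L := p 0.
Let add (t t' : L) : L := p (lift t + lift t').
Let scale a (t : L) : L := p (a *: lift t).
Let opp (t : L) : L := scale (-1) t.
Let addE x y : add (p x) (p y) = p (x + y).
Proof. by apply: pD; rewrite liftK. Qed.
Let scaleE a x : scale a (p x) = p (a *: x).
Proof. by apply: pZ; rewrite liftK. Qed.

Let addA : associative add.
Proof.
by move=> x y z; rewrite -(liftK x) -(liftK y) -(liftK z) !addE addrA.
Qed.
Let addC : commutative add.
Proof. by move=> x y; rewrite -(liftK x) -(liftK y) !addE addrC. Qed.
Let add0 : left_id zero add.
Proof. by move=> x; rewrite -(liftK x) /zero !addE add0r. Qed.
Let addN : left_inverse zero opp add.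
Proof. by move=> x; rewrite -(liftK x) /opp scaleE addE scaleN1r addNr. Qed.

HB.instance Definition _ := Choice.on L.
HB.instance Definition _ := GRing.isZmodule.Build L addA addC add0 addN.

Let scaleA a b t : scale a (scale b t) = scale (a * b) t.
Proof. by rewrite -(liftK t) !scaleE scalerA. Qed.
Let scale1 : left_id 1 scale.
Proof. by move=> t; rewrite -(liftK t) scaleE scale1r. Qed.
Let scaleDr : right_distributive scale +%R.
Proof.
move=> a t u; rewrite -(liftK t) -(liftK u) -[_ + _]/(add _ _).
by rewrite -[RHS]/(add _ _) !(scaleE, addE) scalerDr.
Qed.
Let scaleDl t : {morph scale^~ t : a b / a + b}.
Proof.
move=> a b; rewrite -(liftK t) -[RHS]/(add _ _).
by rewrite !(scaleE, addE) scalerDl.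
Qed.

HB.instance Definition _ := GRing.Zmodule_isLmodule.Build A L
  scaleA scale1 scaleDr scaleDl.

Lemma surj_lmod_linear : linear_for *:%R (p : M -> L).
Proof. by move=> a x y; rewrite -addE -scaleE. Qed.

End TransportSurjection.

Section Substructures.
Variables (V : zfc) (R : diagram V) (K : rmodule R) (P : forall u, set (K u)).
Arguments P : clear implicits.
Local Notation O := (El (obj R)).
Hypotheses (P0 : forall u, P u 0)
  (PD : forall u x y, P u x -> P u y -> P u (x + y))
  (PZ : forall u (r : R u) x, P u x -> P u (r *: x))
  (PA : forall u v (a : El (hom u v)) x, P u x -> P v (rmap K a x)).

Let sset u : V := vset [set z | exists2 x, P u x & z = vmod_val x].

Let ssetE u z : z ∈ sset u <-> exists2 x, P u x & z = vmod_val x.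
Proof.
by apply: (vset_sub (x := vmod_set (K u))) => z' [x _ ->]; exact: elP.
Qed.

Let elt u (t : El (sset u)) : exists2 x : K u, P u x & vmod_val x = \val t.
Proof. by have /ssetE[x Px ->] := elP t; exists x. Qed.

Let i u (t : El (sset u)) : K u := s2val (cid2 (elt t)).
Let iP u (t : El (sset u)) : P u (i t). Proof. exact: (s2valP (cid2 (elt t))). Qed.
Let iE u (t : El (sset u)) : vmod_val (i t) = \val t.
Proof. exact: (s2valP' (cid2 (elt t))). Qed.

Let vmod_val_inj u : injective (fun x : K u => vmod_val x).
Proof. by move=> x y; rewrite /vmod_val => /el_inj. Qed.

Let iI u : injective (@i u).
Proof. by move=> t t' e; apply: el_inj; rewrite -!iE e. Qed.

Let isurj u (x : K u) : P u x -> exists t : El (sset u), i t = x.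
Proof.
move=> Px; have h : vmod_val x ∈ sset u by apply/ssetE; exists x.
by exists (elm h); apply: vmod_val_inj; rewrite iE.
Qed.

Let i0 u : exists t : El (sset u), i t = 0. Proof. exact: isurj. Qed.
Let iD u (t t' : El (sset u)) : exists t'' : El (sset u), i t'' = i t + i t'.
Proof. by apply: isurj; exact: PD. Qed.
Let iZ u (a : R u) (t : El (sset u)) : exists t' : El (sset u), i t' = a *: i t.
Proof. by apply: isurj; exact: PZ. Qed.
Let iA u v (a : El (hom u v)) (t : El (sset u)) : exists t' : El (sset v),
  i t' = rmap K a (i t).
Proof. by apply: isurj; exact: PA. Qed.

Let smod u : vmod V (R u) := @VMod V (R u) (sset u)
  (GRing.Lmodule.class (inj_lmod (@iI u) (@i0 u) (@iD u) (@iZ u))).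

Let inc u : {linear smod u -> K u} :=
  @mk_linear (R u) (smod u) (K u) _ (@i u)
    (@inj_lmod_linear (R u) (K u) (El (sset u)) (@i u) (@iI u) (@i0 u) (@iD u) (@iZ u)).

Let arr u v (a : El (hom u v)) (t : smod u) : smod v := projT1 (cid (iA a t)).
Let arrE u v (a : El (hom u v)) t : inc v (arr a t) = rmap K a (inc u t).
Proof. exact: (projT2 (cid (iA a t))). Qed.

Let incI u : injective (inc u). Proof. exact: iI. Qed.

Let arr_lin u v (a : El (hom u v)) : linear_for ((dmap a) \; *:%R) (arr a).
Proof.
move=> r x y; apply: incI; rewrite arrE !linearD !linearZ /=.
by move: (arrE a x) (arrE a y) => /= -> ->.
Qed.

Let smap u v (a : El (hom u v)) := mk_linear (@arr_lin u v a).

Let smapE u v (a : El (hom u v)) t : inc v (smap a t) = rmap K a (inc u t).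
Proof. exact: arrE. Qed.

Let smap_id u (x : smod u) : smap (idm u) x = x.
Proof. by apply: incI; rewrite smapE rmap_id. Qed.

Let smap_comp u v w (b : El (hom v w)) (a : El (hom u v)) (x : smod u) :
  smap (comp b a) x = smap b (smap a x).
Proof. by apply: incI; rewrite !smapE rmap_comp. Qed.

Lemma substructure_exists : exists L : rmodule R, is_substructure P L.
Proof.
exists (RModule smap_id smap_comp).
exists (@RHom V R (RModule smap_id smap_comp) K inc smapE) => u; split.
  exact: iE.
by apply/seteqP; split=> [_ [t _ <-]|x /isurj[t <-]]; [exact: iP|exists t].
Qed.

Let coset u (x : K u) : V := vset [set z | exists2 y, P u (y - x) & z = vmod_val y].

Let cosetE u (x : K u) z : z ∈ coset x <-> exists2 y, P u (y - x) & z = vmod_val y.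
Proof.
by apply: (vset_sub (x := vmod_set (K u))) => z' [y _ ->]; exact: elP.
Qed.

Let qset u : V := vset (range (@coset u)).

Let qsetE u z : z ∈ qset u <-> exists x : K u, z = coset x.
Proof.
rewrite (vset_smallE (f := @coset u) (small_El (vmod_set (K u)))).
  by split=> [[x _ <-]|[x ->]]; exists x.
by move=> t; split=> [[x _ <-]|[x ->]]; exists x.
Qed.

Let p u (x : K u) : El (qset u) := elm ((qsetE u _).2 (ex_intro _ x erefl)).

Let PN u x : P u x -> P u (- x). Proof. by rewrite -scaleN1r; exact: PZ. Qed.

Let peq u (x y : K u) : p x = p y <-> P u (x - y).
Proof.
split=> [/(congr1 val) /= e|Pxy].
  have : vmod_val x ∈ coset x by apply/cosetE; exists x; rewrite ?subrr.
  by rewrite e => /cosetE[z Pz /vmod_val_inj ->].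
apply: el_inj; apply: zfc_ext => z; rewrite !cosetE.
split=> -[t Pt ->]; exists t => //.
  by rewrite -(subrK x t) -addrA; exact: PD.
by rewrite -(subrK y t) -addrA; apply: PD => //; rewrite -opprB; exact: PN.
Qed.

Let pS u (t : El (qset u)) : exists x, p x = t.
Proof.
by have /qsetE[x e] := elP t; exists x; apply: el_inj.
Qed.

Let pD u (x x' y y' : K u) : p x = p x' -> p y = p y' -> p (x + y) = p (x' + y').
Proof. by move=> /peq hx /peq hy; apply/peq; rewrite opprD addrACA; exact: PD. Qed.
Let pZ u (a : R u) (x x' : K u) : p x = p x' -> p (a *: x) = p (a *: x').
Proof. by move=> /peq hx; apply/peq; rewrite -scalerBr; exact: PZ. Qed.

Let qmod u : vmod V (R u) := @VMod V (R u) (qset u)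
  (GRing.Lmodule.class (surj_lmod (@pS u) (@pD u) (@pZ u))).

Let prj u : {linear K u -> qmod u} :=
  @mk_linear (R u) (K u) (qmod u) _ (@p u)
    (@surj_lmod_linear (R u) (K u) (El (qset u)) (@p u) (@pS u) (@pD u) (@pZ u)).

Let prj_eq u (x y : K u) : prj u x = prj u y <-> P u (x - y). Proof. exact: peq. Qed.
Let prjS u (t : qmod u) : exists x, prj u x = t. Proof. exact: pS. Qed.

Let qarr u v (a : El (hom u v)) (t : qmod u) : qmod v :=
  prj v (rmap K a (projT1 (cid (prjS t)))).
Let qarrE u v (a : El (hom u v)) x : qarr a (prj u x) = prj v (rmap K a x).
Proof.
apply/prj_eq; rewrite -linearB; apply: PA; apply/prj_eq.
exact: (projT2 (cid (prjS (prj u x)))).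
Qed.

Let qarr_lin u v (a : El (hom u v)) : linear_for ((dmap a) \; *:%R) (qarr a).
Proof.
move=> r t s; have [x <-] := prjS t; have [y <-] := prjS s.
rewrite -linearZ -linearD !qarrE linearD linearZ [LHS](linearD (prj v)).
by congr (_ + _); exact: (linearZ_LR (prj v)).
Qed.

Let qmap u v (a : El (hom u v)) := mk_linear (@qarr_lin u v a).

Let qmapE u v (a : El (hom u v)) x : qmap a (prj u x) = prj v (rmap K a x).
Proof. exact: qarrE. Qed.

Let qmap_id u (t : qmod u) : qmap (idm u) t = t.
Proof. by have [x <-] := prjS t; rewrite qmapE rmap_id. Qed.

Let qmap_comp u v w (b : El (hom v w)) (a : El (hom u v)) (t : qmod u) :
  qmap (comp b a) t = qmap b (qmap a t).
Proof.
have [x <-] := prjS t.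
by rewrite !qmapE rmap_comp.
Qed.

Lemma quotient_exists : exists C : rmodule R, is_quotient P C.
Proof.
exists (RModule qmap_id qmap_comp).
have nat u v (a : El (hom u v)) x : prj v (rmap K a x) = qmap a (prj u x).
  exact: (esym (qmapE a x)).
exists (@RHom V R K (RModule qmap_id qmap_comp) prj nat) => u; split.
  by apply/seteqP; split=> // t _; have [x <-] := prjS t; exists x.
by move=> x z; exact: cosetE.
Qed.

End Substructures.

End Constructions.

(** * Drinfeld vector bundles *)

Section Main.
Local Open Scope ring_scope.
Import GRing.Theory.
Variables (V : zfc) (R : diagram V).
Local Notation O := (El (obj R)).
Let theta := card_of V (El (signature R) + nat).
Variables (N : V) (K : rmodule R).
Hypotheses (Nsig : vsub (signature R) N) (N1 : elem1 N)
  (Ncl : lt_closed (succ_card theta) N) (KN : structure_of K ∈ N).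
Variables (L C : rmodule R) (inc : rhom L K) (prj : rhom K C).
Hypotheses (incE : forall u, (forall x, vmod_val (inc u x) = vmod_val x) /\
    range (inc u) = trace N (K := K) (u := u))
  (prjE : forall u, range (prj u) = setT /\
     forall x z, z ∈ vmod_val (prj u x) <->
                 exists2 y, trace N (y - x) & z = vmod_val y).

Lemma inc_inj u : injective (inc u).
Proof.
move=> x y e; have [h _] := incE u.
by apply: el_inj; rewrite -![\val _]/(vmod_val _) -!h e.
Qed.

Lemma prj_surj u c : exists x, prj u x = c.
Proof.
have [h _] := prjE u; have : [set: C u] c by [].
by rewrite -h => -[x _ <-]; exists x.
Qed.

Lemma inc_trace u x : (exists l, inc u l = x) <-> trace N x.
Proof.
have [_ h] := incE u; rewrite -[trace N x]/((trace N (K := K) (u := u)) x) -h.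
by split=> [[l <-]|[l _ <-]]; exists l.
Qed.

Lemma prj_eq0 u x : prj u x = 0 <-> exists l, inc u l = x.
Proof.
rewrite inc_trace; have [_ h] := prjE u.
have tN (y : K u) : trace N y -> trace N (- y).
  by rewrite -scaleN1r; exact: (traceZ Nsig N1 Ncl KN).
split=> [e|tx].
  have : vmod_val x ∈ vmod_val (prj u x).
    by apply/h; exists x => //; rewrite subrr; exact: (trace0 Nsig N1 Ncl KN).
  rewrite e -(linear0 (prj u)) => /h[y ty /el_inj ->].
  by rewrite subr0 in ty.
rewrite -(linear0 (prj u)); apply: el_inj; apply: zfc_ext => z.
rewrite -![\val _]/(vmod_val _) !h; split=> -[y ty ->]; exists y => //.
  by rewrite subr0 -(subrK x y); exact: (traceD Nsig N1 Ncl KN).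
rewrite subr0 in ty; exact: (traceD Nsig N1 Ncl KN) ty (tN _ tx).
Qed.

(** The family is first completed to a set closed under the operations, which
    contains all the zeros. *)
Lemma pure_trace : pure_substructure theta inc.
Proof.
move=> I F It; have nt := nat_theta R.
have Ot : embeds O (El theta).
  by apply: embeds_trans (symbol_theta R); exists (@SZero V R) => u v [].
have [S [S0S tS cS]] := closure_under_ops K
  (tiny_setU nt (tiny_range (fun j => kelt (tagged (F j))) It)
                (tiny_range (fun u : O => kelt (0 : K u)) Ot)).
have [rho rP] := retract_exists Nsig N1 Ncl KN tS.
have S0 u : S (kelt (0 : K u)) by apply: S0S; right; exists u.
pose rL u (x : K u) : L u :=
  if pselect (exists l, inc u l = rho u x) is left h then projT1 (cid h) else 0.
have rLE u (x : K u) : S (kelt x) -> inc u (rL u x) = rho u x.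
  move=> Sx; rewrite /rL; case: pselect => [h|[]]; first exact: (projT2 (cid h)).
  by apply/inc_trace; exact: (retrN rP).
exists (fun u => [set x | S (kelt x)]), rL; split; last first.
  by move=> j; apply: S0S; left; exists j.
split => //.
- by move=> u x y; exact: (closedD cS).
- by move=> u r x; exact: (closedZ cS).
- by move=> u v a x; exact: (closedA cS).
- move=> u x y Sx Sy; apply: inc_inj; have Sxy := closedD cS Sx Sy.
  by rewrite linearD !rLE // (retrD rP).
- move=> u r x Sx; apply: inc_inj; have Srx := closedZ cS r Sx.
  by rewrite linearZ /= !rLE // (retrZ rP).
- move=> u v a x Sx; apply: inc_inj; have Sax := closedA cS a Sx.
  by rewrite rhom_nat !rLE // (retrA rP).
- move=> u l Sl; apply: inc_inj; rewrite rLE // (retr_id rP) //.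
  by apply/inc_trace; exists l.
Qed.

End Main.

Lemma drinfeld_kaplansky (V : zfc) (R : diagram V) (N : V) :
  let theta := card_of V (El (signature R) + nat) in
  appropriate R N -> lt_closed (succ_card theta) N ->
  forall K : qcoh R, drinfeld K -> structure_of K ∈ N ->
    (exists2 L : qcoh R, drinfeld L & is_substructure (trace N (K := K)) L) /\
    (exists2 L : qcoh R, drinfeld L & is_quotient (trace N (K := K)) L).
Proof.
move=> theta [Nsig _ N1] Ncl [K qK] dK /= KN.
have nt : embeds nat (El theta) := nat_theta R.
have sq := hessenberg (small_El theta) nt.
have t0 u : trace N (0%R : K u) := trace0 Nsig N1 Ncl KN u.
have tD u (x y : K u) : trace N x -> trace N y -> trace N (x + y)%R.
  exact: (traceD Nsig N1 Ncl KN).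
have tZ u (r : R u) (x : K u) : trace N x -> trace N (r *: x)%R.
  exact: (traceZ Nsig N1 Ncl KN).
have tA u v (a : El (hom u v)) (x : K u) : trace N x -> trace N (rmap K a x).
  exact: (traceA Nsig N1 Ncl KN).
have [L [inc incE]] := substructure_exists t0 tD tZ tA.
have [C [prj prjE]] := quotient_exists t0 tD tZ tA.
have pS := prj_surj prjE.
have p0 := prj_eq0 Nsig N1 Ncl KN incE prjE.
have pu := pure_trace Nsig N1 Ncl KN incE.
have Rt : forall u, embeds (R u) (El theta) := ring_theta (R := R).
have qL : quasicoherent L.
  by move=> u v a; exact: (quasicoherent_sub nt sq pu (qK u v a)).
have qC : quasicoherent C.
  by move=> u v a; exact: (quasicoherent_quotient nt sq pS p0 pu (qK u v a)).
split.
  exists (QCoh qL); last by exists inc.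
  move=> u; have [fK mK] := dK u; split.
    exact: (flat_sub nt sq pu fK).
  exact: (mittag_leffler_sub nt sq pu mK).
exists (QCoh qC); last by exists prj.
move=> u; have [fK mK] := dK u; split.
  exact: (flat_quotient nt sq pS p0 pu fK).
exact: (mittag_leffler_quotient nt sq Rt pS p0 pu mK).
Qed.

(** (2^theta)^theta = 2^theta, since theta * theta = theta. *)
Lemma power_closed (V : zfc) (theta : V) : cardinal theta -> embeds nat (El theta) ->
  let lambda := succ_card (card_of V (El theta -> bool)) in
  regular lambda /\ forall mu : V, cardinal mu -> mu ∈ lambda ->
    card_of V (El theta -> El mu) ∈ lambda.
Proof.
move=> ct nt lambda; have st := small_El theta.
have sp : small V (El theta -> bool) by apply: small_fun; [|exact: small_count].
have [pc cp] := card_of_bij sp; have cc := card_of_cardinal sp.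
have np : embeds nat (El (card_of V (El theta -> bool))).
  apply: embeds_trans nt (embeds_trans _ pc).
  by exists (fun a b => a == b) => a b /(congr1 (@^~ a)); rewrite eqxx => /esym/eqP.
split; first exact: succ_card_regular.
move=> mu cmu /(succ_card_el cc) mup; have [_ _ sP] := succ_cardP cc.
apply/sP; first exact: small_fun st (small_El mu).
apply: embeds_trans (embeds_fun _ (embeds_trans mup cp)) _.
apply: embeds_trans pc.
apply: (@embeds_trans _ (El theta * El theta -> bool)).
  by exists (fun f p => f p.1 p.2) => f g e; apply/funext => a; apply/funext => b;
     exact: (congr1 (@^~ (a, b)) e).
exact: (embeds_funl (hessenberg st nt) true).
Qed.

Lemma stationary_kaplansky (V : zfc) (R : diagram V) (lambda : V) :
  let theta := card_of V (El (signature R) + nat) in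
  let Gamma := [set N : V | [/\ appropriate R N, smaller_than lambda N
                              & lt_closed (succ_card theta) N]] in
  regular lambda ->
  (forall mu : V, cardinal mu -> mu ∈ lambda ->
     card_of V (El theta -> El mu) ∈ lambda) ->
  stationary lambda Gamma /\ kaplansky (drinfeld (R := R)) Gamma.
Proof.
move=> theta Gamma rl el; have nt : embeds nat (El theta) := nat_theta R.
split; last by move=> N K [aN _ Ncl]; exact: drinfeld_kaplansky.
split=> //.
- rewrite /uncountable /countable => /embedsP ln.
  have /(belowP rl)[_ []] := below_theta rl el; exact: embeds_trans ln nt.
- by move=> N [].
move=> P /(hull rl (theta_cardinal R) nt el (sig_theta R)).
by move=> [N [PN sN sigN N1 [oN lN cN]]]; exists N.
Qed.

Theorem corollary8p2 (V : zfc) (R : diagram V) (flatR : flat_diagram R) :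
  let theta := card_of V (El (signature R) + nat) in
  let kappa := succ_card theta in
  (forall lambda : V,
     regular lambda ->
     (forall mu : V, cardinal mu -> mu ∈ lambda ->
        card_of V (El theta -> El mu) ∈ lambda) ->
     let Gamma := [set N : V | [/\ appropriate R N, smaller_than lambda N
                                 & lt_closed kappa N]] in
     stationary lambda Gamma /\ kaplansky (drinfeld (R := R)) Gamma) /\
  uniformly_stationary_kaplansky (succ_card (card_of V (El theta -> bool)))
                                 (drinfeld (R := R)).
Proof.
move=> theta kappa; split; first exact: stationary_kaplansky.
have [rl el] := power_closed (theta_cardinal R) (nat_theta R).
by have [st ka] := stationary_kaplansky rl el; eexists; [exact: st|exact: ka].
Qed.
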